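(* Let $p\ge 3$ and $1\le s\le 3p-1$ be integers, and let $G$ be a graph on $n=4p-1+s$ vertices with $|E(G)|\le 7s$ and maximum degree $\Delta(G)\le 6$. Then either the complement $\overline{G}$ contains a subgraph isomorphic to $4K_p$, or $3$ divides $s$ and $G$ is isomorphic to $\frac{s}{3}K_7\cup\overline{K}_{n-\frac{7s}{3}}$.
   Context: All graphs are finite and simple. $K_m$ is the complete graph on $m$ vertices, $\overline{K}_m$ is the edgeless graph on $m$ vertices, $\overline{G}$ is the complement of $G$, $kH$ denotes the disjoint union of $k$ copies of $H$, and $\cup$ denotes disjoint union of graphs. *)

(* Defs.v *)
From mathcomp Require Import all_boot.

Set Implicit Arguments.
Unset Strict Implicit.
Unset Printing Implicit Defensive.

Record sgraph := SGraph {
  vertex :> finType;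
  adj : rel vertex;
  adj_sym : symmetric adj;
  adj_irrefl : irreflexive adj }.

Definition edges (G : sgraph) : {set {set G}} :=
  [set [set xy.1; xy.2] | xy : G * G & adj xy.1 xy.2].

Definition degree (G : sgraph) (x : G) : nat := #|[set y | adj x y]|.

Definition max_degree (G : sgraph) : nat := \max_(x : G) degree x.

Section Complement.
Variable G : sgraph.
Definition compl_adj : rel G := fun x y => (x != y) && ~~ adj x y.
Fact compl_adj_sym : symmetric compl_adj.
Proof. by move=> x y; rewrite /compl_adj eq_sym adj_sym. Qed.
Fact compl_adj_irrefl : irreflexive compl_adj.
Proof. by move=> x; rewrite /compl_adj eqxx. Qed.
Definition complement : sgraph := SGraph compl_adj_sym compl_adj_irrefl.
End Complement.

Section Complete.
Variable m : nat.
Definition complete_adj : rel 'I_m := fun x y => x != y.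
Fact complete_adj_sym : symmetric complete_adj.
Proof. by move=> x y; rewrite /complete_adj eq_sym. Qed.
Fact complete_adj_irrefl : irreflexive complete_adj.
Proof. by move=> x; rewrite /complete_adj eqxx. Qed.
Definition complete : sgraph := SGraph complete_adj_sym complete_adj_irrefl.
End Complete.

Section Edgeless.
Variable m : nat.
Definition edgeless_adj : rel 'I_m := fun _ _ => false.
Fact edgeless_adj_sym : symmetric edgeless_adj. Proof. by []. Qed.
Fact edgeless_adj_irrefl : irreflexive edgeless_adj. Proof. by []. Qed.
Definition edgeless : sgraph := SGraph edgeless_adj_sym edgeless_adj_irrefl.
End Edgeless.

Section Copies.
Variables (k : nat) (H : sgraph).
Definition copies_adj : rel ('I_k * H) :=
  fun u v => (u.1 == v.1) && adj u.2 v.2.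
Fact copies_adj_sym : symmetric copies_adj.
Proof. by move=> u v; rewrite /copies_adj eq_sym adj_sym. Qed.
Fact copies_adj_irrefl : irreflexive copies_adj.
Proof. by move=> u; rewrite /copies_adj adj_irrefl andbF. Qed.
Definition copies : sgraph := SGraph copies_adj_sym copies_adj_irrefl.
End Copies.

Section DisjointUnion.
Variables G H : sgraph.
Definition dunion_adj : rel (G + H) := fun u v =>
  match u, v with
  | inl x, inl y => adj x y
  | inr x, inr y => adj x y
  | _, _ => false
  end.
Fact dunion_adj_sym : symmetric dunion_adj.
Proof. by case=> x [] y //=; rewrite adj_sym. Qed.
Fact dunion_adj_irrefl : irreflexive dunion_adj.
Proof. by case=> x /=; rewrite adj_irrefl. Qed.
Definition dunion : sgraph := SGraph dunion_adj_sym dunion_adj_irrefl.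
End DisjointUnion.

Definition isomorphic (G H : sgraph) : Prop :=
  exists f : G -> H, bijective f /\ forall x y, adj (f x) (f y) = adj x y.

(* [G] contains a (not necessarily induced) subgraph isomorphic to [H]. *)
Definition contains_copy (G H : sgraph) : Prop :=
  exists f : H -> G, injective f /\ forall x y, adj x y -> adj (f x) (f y).

(* Main.v *)
Require Import Defs.
From Stdlib Require Import Classical_Prop.
From mathcomp Require Import all_boot zify.

Set Implicit Arguments.
Unset Strict Implicit.
Unset Printing Implicit Defensive.

(** Four disjoint independent [p]-sets are sought. Removing one edge and using induction on the
    number of edges, one may assume that there are such sets except that one of them, the root,
    has only [p - 1] vertices. Call a class accessible if, by moving vertices along a
    sequence of classes, each free of neighbours of the incoming vertex, it can pass a vertex on to
    the root. Among all choices take as many accessible classes as possible, with the least degree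
    sum; let [Z] be the set of the other vertices. Then every vertex [z] of [Z] has a neighbour in
    every accessible class [W] and, whenever it can be spared, exchanging it with its only neighbour
    [w] in [W] shows that [w] has a neighbour in every earlier class, that the vertices of [Z] whose
    only neighbour in [W] is [w] form a clique, and that [w] does not have larger degree than [z] if
    [W] is the last class. If some [z] cannot be spared, the same construction is repeated inside
    [Z] with a root that contains [z]. Distributing the edges over [Z] then shows that there are
    more than [7 s] of them, unless all four classes are accessible. In that case there are at least
    [7 s] edges, and equality forces every vertex outside the classes to have exactly two neighbours
    outside; as this persists under exchanges, each such vertex lies in a component [K_7]. *)

(** * Chains of accessible classes *)

Lemma minimal_witness (T : Type) (P : T -> Prop) (m : T -> nat) :
  (exists x, P x) -> exists x, P x /\ forall y, P y -> m x <= m y.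
Proof.
suff H n x : P x -> m x < n -> exists x, P x /\ forall y, P y -> m x <= m y.
  by case=> x Px; apply: (H (m x).+1 x).
elim: n x => // n IH x Px; rewrite ltnS => le.
case: (classic (exists y, P y /\ m y < m x)) => [[y [Py lt]]|no].
  exact: IH Py (leq_trans lt le).
exists x; split=> // y Py; rewrite leqNgt; apply/negP => lt; apply: no; by exists y.
Qed.

Ltac bsolve :=
  by repeat match goal with
  | |- context [in_mem ?a ?b] => case: (in_mem a b) => //=
  | |- context [?a == ?b] => case: (a == b) => //=
  end.

Section IndependentSets.
Variables (V : finType) (e : rel V) (p : nat).
Hypotheses (e_sym : symmetric e) (e_irr : irreflexive e) (p_gt0 : 0 < p).
Implicit Types (A B C T U W X Z g : {set V}) (L M : seq {set V}) (x y z w : V).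

Definition nb x := [set y | e x y].
Definition free x A := [disjoint nb x & A].
Definition indep A := [forall x in A, free x A].
Definition sole x A y := nb x :&: A == [set y].

(** For [k = 4] and [U] the whole vertex set this is a [4K_p] in the complement. The recursion
    removes one class at a time, which makes the classes disjoint. *)
Fixpoint good k U : bool :=
  if k is k'.+1 then
    [exists B : {set V}, [&& B \subset U, indep B, #|B| == p & good k' (U :\: B)]]
  else true.

Lemma freeP x A : reflect {in A, forall y, ~~ e x y} (free x A).
Proof.
apply: (iffP idP) => [/disjoint_setI0 H y yA|H].
  apply/negP => exy; have: y \in nb x :&: A by rewrite !inE exy.
  by rewrite H inE.
rewrite /free disjoint_subset; apply/subsetP => y; rewrite !inE => exy.
by apply/negP => /H; rewrite exy.
Qed.

Lemma freeS x A B : A \subset B -> free x B -> free x A.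
Proof. by move=> /subsetP sAB /freeP H; apply/freeP => y /sAB /H. Qed.

Lemma freeN x A : ~~ free x A -> exists2 y, y \in A & e x y.
Proof.
case: (boolP [exists y in A, e x y]) => [/exists_inP[y yA exy] _|/exists_inPn H]; first by exists y.
by case/negP; apply/freeP.
Qed.

Lemma card_nbI_gt0 x A : ~~ free x A -> 0 < #|nb x :&: A|.
Proof. by case/freeN => y yA exy; apply/card_gt0P; exists y; rewrite !inE exy. Qed.

Lemma indepP A : reflect {in A &, forall x y, ~~ e x y} (indep A).
Proof.
apply: (iffP forall_inP) => [H x y xA yA|H x xA]; first exact: (freeP _ _ (H x xA)).
by apply/freeP => y; apply: H.
Qed.

Lemma indepS A B : A \subset B -> indep B -> indep A.
Proof. by move=> /subsetP sAB /indepP H; apply/indepP => x y /sAB xB /sAB; apply: H. Qed.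

Lemma indepU1 z A : indep A -> free z A -> indep (z |: A).
Proof.
move=> /indepP iA /freeP zA; apply/indepP => x y /setU1P[->|xA] /setU1P[->|yA].
- by rewrite e_irr.
- exact: zA.
- by rewrite e_sym; apply: zA.
- exact: iA.
Qed.

Lemma soleP x A y : reflect [/\ y \in A, e x y & free x (A :\ y)] (sole x A y).
Proof.
apply: (iffP eqP) => [H|[yA exy /freeP H]].
  have: y \in nb x :&: A by rewrite H set11.
  rewrite !inE => /andP[exy yA]; split=> //; apply/freeP => u; rewrite !inE => /andP[uy uA].
  by apply: contra uy => exu; rewrite -in_set1 -H !inE exu.
apply/setP => u; rewrite !inE; apply/andP/eqP => [[exu uA]|->//].
by apply/eqP/negPn/negP => uy; move: (H u); rewrite !inE uy uA exu => /(_ isT).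
Qed.

Lemma goodS k U U' : U \subset U' -> good k U -> good k U'.
Proof.
elim: k U U' => //= k IH U U' sU /existsP[B /and4P[sB iB cB gB]].
apply/existsP; exists B; rewrite (subset_trans sB sU) iB cB /=.
exact: IH (setSD _ sU) gB.
Qed.

Lemma good_add B k U U' : indep B -> #|B| = p -> B \subset U' -> U \subset U' :\: B ->
  good k U -> good k.+1 U'.
Proof.
move=> iB cB sB sU gU /=; apply/existsP; exists B.
by rewrite sB iB cB eqxx /=; apply: goodS gU.
Qed.

Lemma good_cat i j A B U : [disjoint A & B] -> A \subset U -> B \subset U ->
  good i A -> good j B -> good (i + j) U.
Proof.
elim: i A B U => [|i IH] A B U dAB sA sB; first by move=> _; apply: goodS.
move=> /= /existsP[C /and4P[sC iC cC gC]] gB; apply/existsP; exists C.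
rewrite (subset_trans sC sA) iC cC /=; apply: (IH (A :\: C) B) gC gB.
- exact: disjointWl (subsetDl _ _) dAB.
- exact: setSD.
- rewrite subsetD sB /= disjoint_sym; exact: disjointWl sC dAB.
Qed.

(** Either the packing avoids [z], or [z] lies in one of its classes; as the classes are disjoint,
    that class can be taken out first. *)
Lemma good_split k U z : good k U -> z \in U ->
  good k (U :\ z) \/
  exists k', k = k'.+1 /\ exists B, [/\ z \in B, B \subset U, indep B, #|B| = p & good k' (U :\: B)].
Proof.
elim: k U => [|k IH] U; first by left.
move=> /= /existsP[B /and4P[sB iB /eqP cB gB]] zU.
have [zB|zB] := boolP (z \in B); first by right; exists k; split=> //; exists B.
have zUB : z \in U :\: B by rewrite inE zB.
case: (IH _ gB zUB) => [g|[k' [-> [C [zC sC iC cC gC]]]]].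
  left; apply/existsP; exists B; rewrite subsetD1 sB zB iB cB eqxx /=.
  by move: g; rewrite !setDDl setUC.
right; exists k'.+1; split=> //; exists C; split=> //; first exact: subset_trans sC (subsetDl _ _).
move: sC; rewrite subsetD => /andP[sC dC].
apply/existsP; exists B; rewrite subsetD sB iB cB eqxx /= disjoint_sym dC /=.
by move: gC; rewrite !setDDl setUC.
Qed.

Fixpoint cov L : {set V} := if L is W :: L' then W :|: cov L' else set0.

Lemma cov_cat L M : cov (L ++ M) = cov L :|: cov M.
Proof. by elim: L => [|W L IH] /=; rewrite ?set0U // IH setUA. Qed.

Lemma cov_sup W L : W \in L -> W \subset cov L.
Proof.
elim: L => //= X L IH; rewrite inE => /orP[/eqP->|/IH H]; first exact: subsetUl.
exact: subset_trans H (subsetUr _ _).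
Qed.

(* Lists of classes are stored latest first, so that the root is the last entry; every other
   class has a vertex that can be moved into an earlier one. The ghost set [g] lies in the root
   and is ignored when vertices are moved into it. *)
Fixpoint chain g L : bool :=
  if L is W :: L' then
    if L' is [::] then [&& g \subset W, indep W & #|W :\: g| == p.-1]
    else [&& indep W, #|W| == p, [disjoint W & cov L'],
             has (fun X => [exists y in W, free y (X :\: g)]) L' & chain g L']
  else false.

Lemma chain_cons g W L : L != [::] -> chain g (W :: L) =
  [&& indep W, #|W| == p, [disjoint W & cov L],
      has (fun X => [exists y in W, free y (X :\: g)]) L & chain g L].
Proof. by case: L. Qed.

Lemma chain_consP g W L : L != [::] -> reflect
  [/\ indep W, #|W| = p, [disjoint W & cov L],
      (exists X y, [/\ X \in L, y \in W & free y (X :\: g)]) & chain g L] (chain g (W :: L)).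
Proof.
move=> L0; rewrite chain_cons //; apply: (iffP and5P) => [[? /eqP ? ? /hasP[X XL /exists_inP[y yW fy]] ?]|
  [? ? ? [X [y [XL yW fy]]] ?]]; split=> //; try exact/eqP.
- by exists X, y.
- by apply/hasP; exists X => //; apply/exists_inP; exists y.
Qed.

Lemma chain_ghost g L : chain g L -> g \subset cov L.
Proof.
elim: L => // W [|X L] IH; first by case/and3P => /= H _ _; rewrite setU0.
by case/chain_consP => // _ _ _ _ /IH H; apply: subset_trans H (subsetUr _ _).
Qed.

Lemma chain_disj g W L : chain g (W :: L) -> [disjoint W & cov L].
Proof. by case: L => [|X L]; [rewrite /= -setI_eq0 setI0 | case/chain_consP]. Qed.

Lemma chain_setDg g W L : L != [::] -> chain g (W :: L) -> W :\: g = W.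
Proof.
move=> L0 /chain_consP[]// _ _ dW _ /chain_ghost gL; apply/setDidPl.
exact: disjointWr gL dW.
Qed.

Lemma card_swap A z w : z \notin A -> w \in A -> #|z |: A :\ w| = #|A|.
Proof.
move=> zA wA; rewrite cardsU1 (cardsD1 w A) wA !inE (negPf zA) andbF //.
Qed.

(** Put [z] into [X]. If [X] is not the root, it releases its movable vertex to an earlier class,
    and so on down to the root, which lacks one vertex when the ghost is left out. Classes off this
    path stay as they are. *)
Lemma absorb g L z X : chain g L -> z \notin cov L -> X \in L -> free z (X :\: g) ->
  good (size L) (z |: cov L :\: g).
Proof.
elim: L z X => // W L IH z X; have [->|L0] := eqVneq L [::].
  case/and3P => gW iW /eqP cW /=; rewrite setU0 => zW; rewrite mem_seq1 => /eqP-> fz.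
  have iz : indep (z |: W :\: g) by apply: indepU1 => //; apply: indepS iW; apply: subsetDl.
  apply: (@good_add (z |: W :\: g) 0 set0) => //.
  - by rewrite cardsU1 !inE (negPf zW) andbF cW add1n prednK.
  - exact: sub0set.
move=> chL; have Wg := chain_setDg L0 chL.
case/chain_consP: (chL) => // iW cW dW [X' [y [X'L yW fy]]] ch'.
have gW u : u \in W -> u \notin g by rewrite -{1}Wg inE => /andP[].
have dWL u : u \in cov L -> u \notin W.
  by move=> uL; apply/negP => uW; move/disjointFr: dW => /(_ _ uW); rewrite uL.
rewrite [cov _]/= in_setU negb_or => /andP[zW zL].
have yL : y \notin cov L by move/disjointFr: dW => ->.
rewrite inE => /orP[/eqP-> fz|XL fz].
  rewrite Wg in fz.
  apply: (@good_add (z |: W :\ y) (size L) (y |: cov L :\: g)).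
  - apply: indepU1; first by apply: indepS iW; apply: subD1set.
    by apply: freeS fz; apply: subD1set.
  - by rewrite card_swap.
  - apply/subsetP => u; rewrite !inE => /orP[->//|/andP[_ uW]].
    by rewrite uW gW ?orbT.
  - apply/subsetP => u; rewrite !inE => /orP[/eqP->|/andP[ug uL]].
      by rewrite eqxx yW gW //= !orbT orbF andbT; apply: contra zW => /eqP<-.
    rewrite ug uL !orbT (negPf (dWL _ uL)) andbF orbF andbT.
    by apply: contra zL => /eqP<-.
  - exact: IH X'L fy.
apply: (@good_add W (size L) (z |: cov L :\: g)) => //.
- by apply/subsetP => u uW; rewrite !inE uW gW ?orbT.
- apply/subsetP => u; rewrite !inE => /orP[/eqP->|/andP[ug uL]]; first by rewrite eqxx zW.
  by rewrite ug uL !orbT dWL.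
- exact: IH XL fz.
Qed.

Lemma disjP A B : [disjoint A & B] -> forall u, (u \in A) ==> (u \notin B).
Proof. by move=> d u; apply/implyP => /(disjointFr d) ->. Qed.

Lemma subP A B : A \subset B -> forall u, (u \in A) ==> (u \in B).
Proof. by move=> /subsetP s u; apply/implyP => /s. Qed.

Lemma inP z A : z \in A -> forall u, (u == z) ==> (u \in A).
Proof. by move=> zA u; apply/implyP => /eqP->. Qed.

Lemma niP z A : z \notin A -> forall u, (u == z) ==> (u \notin A).
Proof. by move=> zA u; apply/implyP => /eqP->. Qed.

Lemma disjUl A B C : [disjoint A :|: B & C] = [disjoint A & C] && [disjoint B & C].
Proof. by rewrite -!setI_eq0 setIUl setU_eq0. Qed.

Lemma disj1l z A B : [disjoint z |: A & B] = (z \notin B) && [disjoint A & B].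
Proof. by rewrite disjUl disjoints1. Qed.

Lemma chain_suffix g L1 M : M != [::] -> chain g (L1 ++ M) -> chain g M.
Proof.
move=> M0; elim: L1 => //= W L1 IH; rewrite -/(chain g (W :: (L1 ++ M))).
by case/chain_consP => [|_ _ _ _ /IH]; first by case: (L1) M0.
Qed.

Lemma chain_cat_disj g L1 M : M != [::] -> chain g (L1 ++ M) -> [disjoint cov L1 & cov M].
Proof.
move=> M0; elim: L1 => [|W L1 IH]; first by rewrite /= -setI_eq0 set0I.
have nz : L1 ++ M != [::] by case: (L1) M0.
rewrite cat_cons => /chain_consP[]// _ _ d _ /IH d'; rewrite cov_cat in d.
by rewrite /= disjUl d' andbT; apply: disjointWr d; apply: subsetUr.
Qed.

(** As the root lies in [M], all classes of [L1] are complete and extend any packing of a set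
    disjoint from them. *)
Lemma chain_prefix g L1 M m T U : M != [::] -> chain g (L1 ++ M) ->
  [disjoint T & cov L1] -> T \subset U -> cov L1 \subset U -> good m T ->
  good (size L1 + m) U.
Proof.
move=> M0; elim: L1 U => [|W L1 IH] U; first by move=> _ _ sT _; apply: goodS.
have nz : L1 ++ M != [::] by case: (L1) M0.
rewrite cat_cons -[cov (W :: L1)]/(W :|: cov L1) => /chain_consP[]// iW cW dW _ ch dT sT.
rewrite subUset => /andP[sW sL] gT; rewrite cov_cat in dW; rewrite -[size (W :: L1)]/(size L1).+1 addSn.
apply: (@good_add W _ (U :\: W)) => //; apply: IH => //.
- by apply: disjointWr dT; apply: subsetUr.
- by rewrite subsetD sT; apply: disjointWr dT; apply: subsetUl.
- by rewrite subsetD sL disjoint_sym; apply: disjointWr dW; apply: subsetUl.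
Qed.

Lemma chain_mem_card g L W : chain g L -> W \in L -> #|W :\: g| <= p.
Proof.
elim: L => // X L IH; have [->|L0] := eqVneq L [::].
  by case/and3P => _ _ /eqP c; rewrite mem_seq1 => /eqP->; rewrite c leq_pred.
case/chain_consP => // _ c _ _ ch; rewrite inE => /orP[/eqP->|]; last exact: IH.
by rewrite -c subset_leq_card // subsetDl.
Qed.

(** The exchange could break two kinds of links: that from [W] to an earlier class, if it moves [w],
    and those from later classes into [W], if they move a neighbour of [z]. The last two hypotheses
    exclude these. *)
Lemma swap_chain g L1 W L2 z w : chain g (L1 ++ W :: L2) -> z \notin cov (L1 ++ W :: L2) ->
  w \in W -> w \notin g -> free z (W :\ w) ->
  (forall X, X \in L2 -> ~~ free w (X :\: g)) ->
  (forall X y, X \in L1 -> y \in X -> e z y -> ~~ free y (W :\: g)) ->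
  chain g (L1 ++ (z |: W :\ w) :: L2).
Proof.
move=> ch zL wW wg fz back fwd.
have iW' : indep W -> indep (z |: W :\ w).
  by move=> iW; apply: indepU1 => //; apply: indepS iW; apply: subD1set.
elim: L1 ch zL fwd => [|Y L1 IH].
  have [->|L20] := eqVneq L2 [::].
    case/and3P => gW iW /eqP cW; rewrite /= setU0 => zW _; apply/and3P; split.
    - apply/subsetP => u ug; rewrite !inE (subsetP gW) // andbT.
      by apply/orP; right; apply: contra wg => /eqP<-.
    - exact: iW'.
    - rewrite -cW -(@card_swap (W :\: g) z w).
      + apply/eqP; apply: eq_card => u; rewrite !inE.
        by move: (niP zW u) (subP gW u); bsolve.
      + by rewrite inE (negPf zW) andbF.
      + by rewrite inE wg.
  case/chain_consP => // iW cW dW [X [y [XL yW fy]]] ch.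
  rewrite /= in_setU negb_or => /andP[zW zL] _.
  rewrite -/(chain g ((z |: W :\ w) :: L2)); apply/chain_consP => //; split=> //.
  - exact: iW'.
  - by rewrite card_swap.
  - rewrite disj1l zL /=; apply: disjointWl dW; apply: subD1set.
  - exists X, y; split=> //; rewrite !inE yW andbT; apply/orP; right.
    by apply/negP => /eqP yw; move: (back X XL); rewrite -yw fy.
have nz : forall X, L1 ++ X :: L2 != [::] by move=> X; case: (L1).
rewrite !cat_cons => /chain_consP[]// iY cY dY [X [y [XL yY fy]]] ch.
rewrite /= in_setU negb_or => /andP[zY zL] fwd.
rewrite -/(chain g (Y :: (L1 ++ _ :: L2))); apply/chain_consP => //; split=> //.
- rewrite disjoint_sym; apply: (@disjointWl _ _ (mem (z |: cov (L1 ++ W :: L2)))).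
    rewrite !cov_cat /=; apply/subsetP => u; rewrite !inE.
    by do !case: (_ \in _); rewrite ?orbT //= !orbF ?andbF ?orbF => ->.
  by rewrite disj1l zY disjoint_sym.
- move: XL; rewrite mem_cat inE => /or3P[XL|/eqP XW|XL].
  + by exists X, y; split=> //; rewrite mem_cat XL.
  + exists (z |: W :\ w), y; rewrite mem_cat inE eqxx orbT; split=> //.
    rewrite XW in fy; apply/freeP => u; rewrite !inE => /andP[ug /orP[/eqP->|/andP[_ uW]]].
      apply/negP => eyz; move: (fwd Y y); rewrite inE eqxx e_sym eyz fy => /(_ isT yY isT).
      by [].
    by apply: (freeP _ _ fy); rewrite inE ug.
  + by exists X, y; split=> //; rewrite mem_cat inE XL !orbT.
- by apply: IH => // X' y' X'L; apply: fwd; rewrite inE X'L orbT.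
Qed.

(** * Extremal choice of a chain inside a set [U] *)

Section Level.
Variables (U : {set V}) (c : nat) (g : {set V}).
Hypothesis bad : ~~ good c (U :\: g).

(** A completable chain: the vertices outside it contain the missing [c - size L] classes, so that
    filling its root without the ghost would contradict [bad]. *)
Definition lv L :=
  [/\ chain g L, cov L \subset U, size L <= c & good (c - size L) (U :\: cov L)].

Definition longest L := lv L /\ forall M, lv M -> size M <= size L.

Lemma bad_cat i j A B : i + j = c -> [disjoint A & B] -> A \subset U :\: g ->
  B \subset U :\: g -> good i A -> good j B -> False.
Proof. by move=> ij d sA sB gA gB; case/negP: bad; rewrite -ij; apply: good_cat gA gB. Qed.

Lemma lv_rest L z : lv L -> z \in U :\: cov L ->
  [/\ z \notin cov L, z \in U & z \notin g].
Proof.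
case=> /chain_ghost gL _ _ _; rewrite inE => /andP[zL zU]; split=> //.
by apply: contra zL; apply: (subsetP gL).
Qed.

(** Suppose [z] has no neighbour there. If the missing classes can avoid [z], absorbing [z]
    completes a packing; otherwise the class containing [z] prolongs the chain, since it can send
    [z] into [X]. *)
Lemma longest_nb L z X : longest L -> z \in U :\: cov L -> X \in L -> ~~ free z (X :\: g).
Proof.
move=> [lvL mx] zZ XL; apply/negP => fz; have [zL zU zg] := lv_rest lvL zZ.
case: (lvL) => ch sL sc gZ; have gL := chain_ghost ch.
case: (good_split gZ zZ) => [gz|[k [kE [B [zB sB iB cB gB]]]]].
  apply: (bad_cat _ _ _ _ (absorb ch zL XL fz) gz); first by rewrite subnKC.
  - rewrite disjoint_subset; apply/subsetP => u; rewrite !inE; bsolve.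
  - apply/subsetP => u; move: (subP sL u) (inP zU u) (niP zg u); rewrite !inE; bsolve.
  - apply/subsetP => u; move: (subP gL u); rewrite !inE; bsolve.
have L0 : L != [::] by case: (L) XL.
move: sB; rewrite subsetD => /andP[sB dB].
suff /mx : lv (B :: L) by rewrite /= ltnn.
split; [apply/chain_consP => //; split=> // | by rewrite /= subUset sB | by move: kE; clear => /=; lia |].
  by exists X, z.
have -> : c - size (B :: L) = k by move: kE; clear => /=; lia.
by move: gB; rewrite setDDl setUC.
Qed.

Lemma sole_ghost L z W w : longest L -> z \in U :\: cov L -> W \in L -> sole z W w ->
  [/\ w \in W, w \notin g & free z (W :\ w)].
Proof.
move=> lo zZ WL /soleP[wW ezw fz]; split=> //.
case/freeN: (longest_nb lo zZ WL) => y; rewrite inE => /andP[yg yW] ezy.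
case: (eqVneq y w) => [<-//|yw]; move/freeP: fz => /(_ y); rewrite !inE yw yW ezy.
by move=> /(_ isT).
Qed.

(** Otherwise [z] takes the place of [w] in [W] and [w] is absorbed by the chain [L2]. As the
    missing classes spare [z], this yields all [c] classes. *)
Lemma lv_back L1 W L2 z w X : let L := L1 ++ W :: L2 in lv L -> z \in U :\: cov L ->
  good (c - size L) ((U :\: cov L) :\ z) -> w \in W -> free z (W :\ w) -> X \in L2 ->
  ~~ free w (X :\: g).
Proof.
move=> L lvL zZ gz wW fz XL; apply/negP => fw; have [zL zU zg] := lv_rest lvL zZ.
case: (lvL) => ch sL sc _; have L20 : L2 != [::] by case: (L2) XL.
have W0 : W :: L2 != [::] by [].
have chW := chain_suffix W0 ch; have d1 := chain_cat_disj W0 ch.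
case/chain_consP: (chW) => // iW cW dW _ ch2; have gL := chain_ghost ch2.
move: zL sL d1; rewrite cov_cat [cov (W :: L2)]/= => zL sL d1.
have [zL1 zW zL2] : [/\ z \notin cov L1, z \notin W & z \notin cov L2].
  by move: zL; rewrite !inE !negb_or => /and3P.
have wL2 : w \notin cov L2 by move/disjointFr: dW => ->.
have gA := absorb ch2 wL2 XL fw.
have g1 : good (size L2).+1 ((z |: W :\ w) :|: (w |: cov L2 :\: g)).
  apply: (good_add (B := z |: W :\ w) _ _ _ _ gA).
  - by apply: indepU1 => //; apply: indepS iW; apply: subD1set.
  - by rewrite card_swap.
  - exact: subsetUl.
  - apply/subsetP => u; move: (disjP dW u) (niP zW u) (niP zL2 u) (inP wW u); rewrite !inE; bsolve.
have dT : [disjoint (z |: W :\ w) :|: (w |: cov L2 :\: g) & cov L1].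
  rewrite disjoint_subset; apply/subsetP => u; move: (disjP d1 u) (niP zL1 u) (inP wW u).
  by rewrite !inE; bsolve.
have g2 := @chain_prefix g L1 (W :: L2) _ _ (z |: cov L :\: g) W0 ch dT _ _ g1.
apply: (bad_cat _ _ _ _ (g2 _ _) gz).
- by rewrite -[RHS](subnKC sc) /L size_cat.
- rewrite disjoint_subset; apply/subsetP => u; rewrite !inE; bsolve.
- apply/subsetP => u; move: (subP sL u) (inP zU u) (niP zg u); rewrite /L cov_cat !inE; bsolve.
- apply/subsetP => u; move: (subP gL u); rewrite /L cov_cat !inE; bsolve.
- apply/subsetP => u; move: (disjP dW u) (inP wW u) (subP gL u) (niP zg u); rewrite /L cov_cat !inE; bsolve.
- apply/subsetP => u; move: (disjP d1 u) (subP gL u); rewrite /L cov_cat !inE; bsolve.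
Qed.

(** Two non-adjacent vertices could both enter [W] in place of [w]. This fills a root; any other
    class then has one vertex too many and passes its movable vertex on. *)
Lemma lv_clique L1 W L2 z z' w : let L := L1 ++ W :: L2 in let Z := U :\: cov L in
  longest L -> z \in Z -> z' \in Z -> z != z' -> good (c - size L) (Z :\ z :\ z') ->
  sole z W w -> sole z' W w -> e z z'.
Proof.
move=> L Z lo zZ z'Z zz' gz so so'; apply/negPn/negP => nzz'; have lvL := lo.1.
have WL : W \in L by rewrite mem_cat inE eqxx orbT.
have [wW wg fz] := sole_ghost lo zZ WL so; have [_ _ fz'] := sole_ghost lo z'Z WL so'.
have [zL zU zg] := lv_rest lvL zZ; have [z'L z'U z'g] := lv_rest lvL z'Z.
case: (lvL) => ch sL sc _; have W0 : W :: L2 != [::] by [].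
have chW := chain_suffix W0 ch; have d1 := chain_cat_disj W0 ch.
have gz1 : good (c - size L) (Z :\ z) by apply: goodS gz; apply: subD1set.
move: zL z'L sL d1; rewrite /L cov_cat [cov (W :: L2)]/= => zL z'L sL d1.
have [zL1 zW zL2] : [/\ z \notin cov L1, z \notin W & z \notin cov L2].
  by move: zL; rewrite !inE !negb_or => /and3P.
have [z'L1 z'W z'L2] : [/\ z' \notin cov L1, z' \notin W & z' \notin cov L2].
  by move: z'L; rewrite !inE !negb_or => /and3P.
have gC := chain_ghost chW.
suff [T [sT dT gT]] : exists T, [/\ T \subset z |: (z' |: (W :|: cov L2)) :\: g,
    [disjoint T & cov L1] & good (size L2).+1 T].
  have g2 := @chain_prefix g L1 (W :: L2) _ _ (z |: (z' |: cov L) :\: g) W0 ch dT _ _ gT.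
  apply: (bad_cat _ _ _ _ (g2 _ _) gz).
  - by rewrite -[RHS](subnKC sc) /L size_cat.
  - rewrite disjoint_subset; apply/subsetP => u; rewrite !inE; bsolve.
  - apply/subsetP => u; move: (subP sL u) (inP zU u) (niP zg u) (inP z'U u); rewrite ?/Z /L ?cov_cat !inE; bsolve.
  - apply/subsetP => u; move: (subP gC u); rewrite ?/Z /L ?cov_cat !inE; bsolve.
  - apply: subset_trans sT _; apply/subsetP => u; rewrite ?/Z /L ?cov_cat !inE; bsolve.
  - apply/subsetP => u; move: (disjP d1 u) (subP gC u); rewrite ?/Z /L ?cov_cat !inE; bsolve.
have iW2 : indep W -> indep (z |: (z' |: W :\ w)).
  move=> iW; apply: indepU1.
    by apply: indepU1 => //; apply: indepS iW; apply: subD1set.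
  by apply/freeP => u /setU1P[->//|]; apply: (freeP _ _ fz).
have [L2E|L20] := eqVneq L2 [::].
  move: chW gC; rewrite L2E => /and3P[gW iW /eqP cW] _.
  exists ((z |: (z' |: W :\ w)) :\: g); split.
  - apply/subsetP => u; rewrite !inE; bsolve.
  - rewrite disjoint_subset; apply/subsetP => u.
    move: (disjP d1 u) (niP zL1 u) (niP z'L1 u); rewrite !inE; bsolve.
  - apply: (@good_add ((z |: (z' |: W :\ w)) :\: g) 0 set0) => //; last exact: sub0set.
    + by apply: indepS (iW2 iW); apply: subsetDl.
    + have -> : (z |: (z' |: W :\ w)) :\: g = z |: (z' |: (W :\: g) :\ w).
        apply/setP => u; move: (niP zg u) (niP z'g u); rewrite !inE; bsolve.
      rewrite !cardsU1 !inE (negPf zz') (negPf zW) (negPf z'W) !andbF.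
      have := cardsD1 w (W :\: g); rewrite cW !inE wW wg /=; move: p_gt0; clear; lia.
case/chain_consP: (chW) => // iW cW dW [X [y [XL yW fy]]] ch2.
(* By [lv_back], [w] cannot move to an earlier class, so the movable vertex is a different one and
   removing both leaves [p - 2] vertices. *)
have yw : y != w.
  by apply/negP => /eqP yw; move: (lv_back lvL zZ gz1 wW fz XL); rewrite -yw fy.
have yL2 : y \notin cov L2 by move/disjointFr: dW => ->.
have gA := absorb ch2 yL2 XL fy; have gL := chain_ghost ch2.
exists ((z |: (z' |: W :\ w :\ y)) :|: (y |: cov L2 :\: g)); split.
- apply/subsetP => u; move: (disjP dW u) (subP gL u) (inP yW u) (niP zg u) (niP z'g u);
  rewrite !inE; bsolve.
- rewrite disjoint_subset; apply/subsetP => u.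
  move: (disjP d1 u) (niP zL1 u) (niP z'L1 u) (inP yW u); rewrite !inE; bsolve.
- apply: (good_add (B := z |: (z' |: W :\ w :\ y)) _ _ _ _ gA).
  + apply: indepS (iW2 iW); apply: setUS; apply: setUS; apply: subD1set.
  + rewrite !cardsU1 !inE (negPf zz') (negPf zW) (negPf z'W) !andbF.
    have := cardsD1 w W; have := cardsD1 y (W :\ w); rewrite cW !inE yw yW wW /=; clear; lia.
  + exact: subsetUl.
  + apply/subsetP => u; move: (disjP dW u) (niP zL2 u) (niP z'L2 u) (niP zW u) (niP z'W u) (inP yW u).
    by rewrite !inE; bsolve.
Qed.

Lemma longest_swap L1 W L2 z w : let L := L1 ++ W :: L2 in let Z := U :\: cov L in
  longest L -> z \in Z -> good (c - size L) (Z :\ z) -> sole z W w ->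
  (forall X y, X \in L1 -> y \in X -> e z y -> ~~ free y (W :\: g)) ->
  longest (L1 ++ (z |: W :\ w) :: L2) /\
  cov (L1 ++ (z |: W :\ w) :: L2) = z |: cov L :\ w.
Proof.
move=> L Z lo zZ gz so fwd; have lvL := lo.1.
have WL : W \in L by rewrite mem_cat inE eqxx orbT.
have [wW wg fz] := sole_ghost lo zZ WL so.
have [zL zU zg] := lv_rest lvL zZ.
case: (lvL) => ch sL sc _; have W0 : W :: L2 != [::] by [].
have chW := chain_suffix W0 ch; have d1 := chain_cat_disj W0 ch; have dW := chain_disj chW.
have wL1 : w \notin cov L1.
  by move: d1; rewrite disjoint_sym => /disjointFr -> //=; rewrite inE wW.
have wL2 : w \notin cov L2 by move/disjointFr: dW => ->.
set L' := L1 ++ _ :: L2.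
have cE : cov L' = z |: cov L :\ w.
  apply/setP => u; move: (niP wL1 u) (niP wL2 u); rewrite /L' /L !cov_cat !inE; bsolve.
have sE : size L' = size L by rewrite /L' /L !size_cat.
split=> //; split; last by move=> M /(lo.2); rewrite sE.
split; last 1 first.
- rewrite sE; apply: goodS gz; rewrite cE.
  apply/subsetP => u; rewrite !inE; bsolve.
- by apply: swap_chain => // X XL; apply: lv_back lvL zZ gz wW fz XL.
- rewrite cE; apply/subsetP => u; move: (subP sL u) (inP zU u); rewrite !inE; bsolve.
- by rewrite sE.
Qed.

(** If [z'] were not adjacent to [z], it would have no neighbour in the class obtained by the
    exchange, against [longest_nb]. Here only [z] has to be spared, in contrast to the pair in
    [lv_clique]. *)
Lemma longest_swap_clique L1 W L2 z z' w : let L := L1 ++ W :: L2 in let Z := U :\: cov L in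
  longest L -> z \in Z -> good (c - size L) (Z :\ z) -> sole z W w ->
  (forall X y, X \in L1 -> y \in X -> e z y -> ~~ free y (W :\: g)) ->
  z' \in Z -> z != z' -> sole z' W w -> e z z'.
Proof.
move=> L Z lo zZ gz so fwd z'Z zz' so'; apply/negPn/negP => nzz'.
have [lo' cE] := longest_swap lo zZ gz so fwd.
have [z'L z'U z'g] := lv_rest lo.1 z'Z.
have z'Z' : z' \in U :\: cov (L1 ++ (z |: W :\ w) :: L2).
  by rewrite cE !inE z'U eq_sym (negPf zz') (negPf z'L) andbF.
have := longest_nb lo' z'Z' (_ : z |: W :\ w \in _); rewrite mem_cat inE eqxx orbT.
move=> /(_ isT) /negP; apply.
case/soleP: so' => wW _ /freeP fz'; apply/freeP => u; rewrite !inE => /andP[_ /orP[/eqP->|H]].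
  by rewrite e_sym.
by apply: fz'; rewrite !inE.
Qed.

(** The only neighbour of [z] in a later class is itself subject to [lv_back], hence has a neighbour
    in the earlier class [W]. This supplies the condition on later classes in [longest_swap]. *)
Lemma sole_later L1 W L2 z : let L := L1 ++ W :: L2 in let Z := U :\: cov L in
  longest L -> z \in Z -> good (c - size L) (Z :\ z) ->
  (forall X, X \in L1 -> exists y, sole z X y) ->
  forall X y, X \in L1 -> y \in X -> e z y -> ~~ free y (W :\: g).
Proof.
move=> L Z lo zZ gz so X y XL yX ezy; have [y' soy] := so X XL.
have [M1 [M2 L1E]] : exists M1 M2, L1 = M1 ++ X :: M2.
  by case/path.splitPr: XL => M1 M2; exists M1, M2.
have LE : L = M1 ++ X :: (M2 ++ W :: L2) by rewrite /L L1E -catA cat_cons.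
have yy : y' = y.
  case/soleP: soy => _ _ /freeP H; apply/eqP/negPn/negP => yy'.
  by move: (H y); rewrite !inE eq_sym yy' yX ezy => /(_ isT).
case/soleP: soy => _ _; rewrite yy => fz.
move: lo.1 zZ gz; rewrite /Z LE => lvL zZ gz.
by apply: (lv_back lvL zZ gz yX fz); rewrite mem_cat inE eqxx orbT.
Qed.

Definition degsum L := \sum_(x in cov L) #|nb x :&: U|.

Definition optimal L := longest L /\ forall M, lv M -> size M = size L -> degsum L <= degsum M.

(** No later class can be disturbed by an exchange in the latest one, so the new chain competes for
    the least [degsum]. *)
Lemma optimal_deg W L2 z w : let L := W :: L2 in let Z := U :\: cov L in
  optimal L -> z \in Z -> good (c - size L) (Z :\ z) -> sole z W w ->
  #|nb w :&: U| <= #|nb z :&: U|.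
Proof.
move=> L Z [lo mn] zZ gz so.
have WL : W \in L by rewrite inE eqxx.
have [[lvM _] cE] := @longest_swap [::] W L2 z w lo zZ gz so (fun X y XL => False_ind _ (notF XL)).
have := mn _ lvM (erefl _); rewrite /degsum cE.
have [wW wg fz] := sole_ghost lo zZ WL so.
have [zL zU zg] := lv_rest lo.1 zZ.
rewrite -/L (big_setD1 w) /=; last by rewrite inE wW.
by rewrite big_setU1 ?leq_add2r //= inE negb_and zL orbT.
Qed.

Lemma optimal_exists L : lv L -> exists M, optimal M.
Proof.
move=> lvL; have [M [lvM mn]] := minimal_witness (fun M => c - size M) (ex_intro _ L lvL).
have lo : longest M.
  split=> // M' lvM'; have := mn _ lvM'; case: lvM lvM' => _ _ h _ [_ _ h' _].
  by move: h h'; clear; lia.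
have P0 : lv M /\ size M = size M by [].
have [M1 [[lv1 s1] mn1]] :=
  minimal_witness (P := fun M' => lv M' /\ size M' = size M) degsum (ex_intro _ M P0).
exists M1; split; first by split=> // M' /(lo.2); rewrite s1.
by move=> M' lvM' sM'; apply: mn1; rewrite sM'.
Qed.

End Level.

(* [core L Z k]: the classes of [L] together with [k] further classes taken from [Z] would solve
   the problem if one more vertex of [Z] could be squeezed into [L]; the hypotheses
   [good k (Z :\ z)] say that [z] can be spared. *)
Record core L Z k : Prop := Core {
  core_disj : pairwise (fun A B => [disjoint A & B]) (Z :: L);
  core_nb : forall z W, z \in Z -> W \in L -> ~~ free z W;
  core_back : forall L1 W L2 z w X, L = L1 ++ W :: L2 -> z \in Z -> good k (Z :\ z) ->
    sole z W w -> X \in L2 -> ~~ free w X;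
  core_clique : forall W w z z', W \in L -> z \in Z -> z' \in Z -> z != z' ->
    good k (Z :\ z :\ z') -> sole z W w -> sole z' W w -> e z z';
  core_clique0 : forall W w z z', W \in L -> z \in Z -> z' \in Z -> z != z' ->
    good k (Z :\ z) -> (forall X, X \in L -> exists y, sole z X y) ->
    sole z W w -> sole z' W w -> e z z' }.

Lemma core_nil Z k : core [::] Z k.
Proof. by split=> //; case. Qed.

Lemma chain_pairwise g L : chain g L -> pairwise (fun A B => [disjoint A & B]) L.
Proof.
elim: L => // W L IH; have [->//|L0] := eqVneq L [::].
case/chain_consP => // _ _ d _ /IH; rewrite pairwise_cons => ->; rewrite andbT.
by apply/allP => X XL; apply: disjointWr d; apply: cov_sup.
Qed.

(** A ghost of one vertex completes the root to [p] vertices, so with the ghost included the whole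
    chain is a packing. *)
Lemma chain_full g L m T U : #|g| = 1 -> chain g L -> [disjoint T & cov L] -> T \subset U ->
  cov L \subset U -> good m T -> good (size L + m) U.
Proof.
move=> g1; elim: L U => // W L IH U; have [->|L0] := eqVneq L [::].
  case/and3P => gW iW /eqP cW; rewrite [cov _]/= setU0 => dT sT sW gT.
  rewrite add1n; apply: (good_add (B := W) iW _ sW _ gT).
    have := cardsD W g; rewrite cW (setIidPr gW) g1; have := subset_leq_card gW; rewrite g1.
    by move: p_gt0; clear; lia.
  by rewrite subsetD sT.
case/chain_consP => // iW cW dW _ ch.
rewrite -[cov (W :: L)]/(W :|: cov L) disjoint_sym disjUl subUset => /andP[d1 d2] sT /andP[sW sL] gT.
rewrite -[size (W :: L)]/(size L).+1 addSn.
apply: (good_add (B := W) iW cW sW (subxx _)); apply: IH gT => //.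
- by rewrite disjoint_sym.
- by rewrite subsetD sT disjoint_sym.
- by rewrite subsetD sL disjoint_sym.
Qed.

Lemma cat_split (L' L L1 : seq {set V}) W L2 : L' ++ L = L1 ++ W :: L2 ->
  (exists2 M, L' = L1 ++ W :: M & L2 = M ++ L) \/ (exists M, L = M ++ W :: L2).
Proof.
elim: L' L1 => [|X L' IH] L1 /=; first by move=> ->; right; exists L1.
case: L1 => [|Y L1] /= [XE]; first by rewrite XE => <-; left; exists L'.
by case/IH => [[M -> ->]|H]; [left; exists M; rewrite ?XE|right].
Qed.

(** The inner chain is placed on top of the outer classes [L]. With a ghost of one vertex the inner
    classes are complete, so whatever is spared by the missing classes is also spared at the outer
    level, and the outer properties are inherited. At the outermost level, [L = [::]], there is
    nothing to inherit. *)
Lemma core_extend L U c g L' : core L U c -> L = [::] \/ #|g| = 1 ->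
  ~~ good c (U :\: g) -> longest U c g L' ->
  core (L' ++ L) (U :\: cov L') (c - size L').
Proof.
move=> [dj nbL bk cl cl0] gL bad lo; have [ch sL sc gZ] := lo.1.
have LZ z : z \in U :\: cov L' -> z \in U by rewrite inE => /andP[].
have sZ : U :\: cov L' \subset U by apply: subsetDl.
have L'U X : X \in L' -> X \subset U by move=> /cov_sup H; apply: subset_trans sL.
have spare T : L = [::] \/ good (c - size L') T -> T \subset U :\: cov L' ->
    forall A, A \subset U :\: cov L' -> T = (U :\: cov L') :\: A -> L = [::] \/ good c (U :\: A).
  case=> [->|gT sT A sA TE]; first by left.
  case: gL => [->|g1]; first by left.
  right; rewrite -(subnKC sc); apply: (chain_full g1 ch _ _ _ gT).
  - by rewrite disjoint_subset; apply/subsetP => u /(subsetP sT); rewrite !inE => /andP[].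
  - by rewrite TE; apply: setSD.
  - by rewrite subsetD sL disjoint_sym disjoint_subset; apply/subsetP => u /(subsetP sA); rewrite !inE => /andP[].
have spare1 z : z \in U :\: cov L' -> good (c - size L') ((U :\: cov L') :\ z) ->
    L = [::] \/ good c (U :\ z).
  by move=> zZ gz; apply: (spare _ (or_intror gz)); rewrite ?subD1set ?sub1set.
split.
- rewrite -cat_cons pairwise_cat; apply/and3P; split; last by case/andP: dj.
    case/andP: dj => /allP dU _; apply/allrelP => A B; rewrite inE => /orP[/eqP->|AL] BL.
      exact: disjointWl sZ (dU B BL).
    exact: disjointWl (L'U A AL) (dU B BL).
  rewrite pairwise_cons (chain_pairwise ch) andbT; apply/allP => X /cov_sup XL.
  rewrite disjoint_sym disjoint_subset; apply/subsetP => u /(subsetP XL).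
  by rewrite !inE => ->.
- move=> z W zZ; rewrite mem_cat => /orP[WL|]; last exact: nbL (LZ _ zZ).
  by apply: contra (longest_nb bad lo zZ WL); apply: freeS; apply: subsetDl.
- move=> L1 W L2 z w X /cat_split[[M L'E ->]|[M LE]] zZ gz so.
    have WL : W \in L' by rewrite L'E mem_cat inE eqxx orbT.
    rewrite mem_cat => /orP[XM|XL].
      have [wW wg fz] := sole_ghost bad lo zZ WL so.
      move: lo.1 zZ gz; rewrite L'E => lvL zZ gz.
      by apply: contra (lv_back bad lvL zZ gz wW fz XM); apply: freeS; apply: subsetDl.
    apply: nbL XL; apply: (subsetP (L'U _ WL)); by case/soleP: so.
  case: (spare1 z zZ gz) => [L0|gz']; first by move: LE; rewrite L0; case: (M).
  by move=> XL; apply: bk LE (LZ _ zZ) gz' so XL.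
- move=> W w z z'; rewrite mem_cat => /orP[WL|WL] zZ z'Z zz' gz so so'.
    move: lo zZ z'Z gz; case/path.splitPr: WL => L1 L2 lo zZ z'Z gz.
    exact: (lv_clique bad lo zZ z'Z zz' gz so so').
  apply: (cl W w z z' WL (LZ _ zZ) (LZ _ z'Z) zz' _ so so').
  have sT : (U :\: cov L') :\ z :\ z' \subset U :\: cov L'.
    exact: subset_trans (subD1set _ _) (subD1set _ _).
  have [||L0|] := spare _ (or_intror gz) sT [set z; z'].
  + by rewrite subUset !sub1set zZ.
  + by rewrite setDDl.
  + by rewrite L0 in WL.
  + by rewrite setDDl.
- move=> W w z z'; rewrite mem_cat => /orP[WL|WL] zZ z'Z zz' gz al so so'.
    have al' X : X \in L' -> exists y, sole z X y by move=> XL; apply: al; rewrite mem_cat XL.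
    move: lo zZ z'Z gz al'; case/path.splitPr: WL => L1 L2 lo zZ z'Z gz al'.
    apply: (longest_swap_clique bad lo zZ gz so _ z'Z zz' so').
    apply: (sole_later bad lo zZ gz) => X XL; apply: al'; by rewrite mem_cat XL.
  case: (spare1 z zZ gz) => [L0|gz']; first by rewrite L0 in WL.
  apply: cl0 WL (LZ _ zZ) (LZ _ z'Z) zz' gz' _ so so' => X XL.
  by apply: al; rewrite mem_cat XL orbT.
Qed.

End IndependentSets.

(** * Discharging *)

Section Discharging.
Variables (V : finType) (e : rel V).
Hypotheses (e_sym : symmetric e) (deg6 : forall x, #|nb e x| <= 6).
Implicit Types (A B C S W Z R : {set V}) (x y z w : V).

Local Notation "'N' x" := (nb e x) (at level 10, x at level 8).

(** Edges are counted by their ends: [links A A] counts each inner edge twice, and [ends] is the sum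
    of all degrees. *)
Definition links A B := \sum_(x in A) #|N x :&: B|.
Definition ends := \sum_x #|N x|.

Lemma card_nbI x A : #|N x :&: A| = \sum_(y in A) e x y.
Proof.
rewrite -sum1_card (eq_bigl (fun y => (y \in A) && e x y)); last by move=> y; rewrite !inE andbC.
by rewrite big_mkcondr; apply: eq_bigr => y _; case: (e x y).
Qed.

Lemma card_split x A B : [disjoint A & B] -> #|N x :&: (A :|: B)| = #|N x :&: A| + #|N x :&: B|.
Proof.
by move=> d; rewrite setIUr cardsU setIACA setIid (disjoint_setI0 d) setI0 cards0 subn0.
Qed.

Lemma links_sym A B : links A B = links B A.
Proof.
rewrite /links (eq_bigr _ (fun x _ => card_nbI x B)) exchange_big.
by apply: eq_bigr => x _; rewrite card_nbI; apply: eq_bigr => y _; rewrite e_sym.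
Qed.

Lemma linksUr A B C : [disjoint B & C] -> links A (B :|: C) = links A B + links A C.
Proof.
move=> d; rewrite /links -big_split; apply: eq_bigr => x _.
exact: card_split.
Qed.

Lemma linksUl A B C : [disjoint A & B] -> links (A :|: B) C = links A C + links B C.
Proof. by move=> d; rewrite ![links _ C]links_sym linksUr. Qed.

Lemma links_ends A : links A A <= ends.
Proof.
rewrite /ends (bigID (mem A)) /=; apply: leq_trans (leq_addr _ _).
by apply: leq_sum => x _; apply: subset_leq_card; apply: subsetIl.
Qed.

Lemma linksUU A B : [disjoint A & B] ->
  links (A :|: B) (A :|: B) = links A A + 2 * links A B + links B B.
Proof. by move=> d; rewrite linksUl // !linksUr // [links B A]links_sym; lia. Qed.

Lemma sumMl c A (F : V -> nat) : \sum_(x in A) c * F x = c * \sum_(x in A) F x.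
Proof. by rewrite big_distrr. Qed.

Lemma sum_share A (F : V -> nat) M : (forall x, x \in A -> F x * #|A| <= M) ->
  \sum_(x in A) F x <= M.
Proof.
move=> H; have [A0|A0] := posnP #|A|; first by rewrite (cards0_eq A0) big_set0.
rewrite -(leq_pmul2r A0) big_distrl /= mulnC -sum_nat_const.
by apply: leq_sum => x /H.
Qed.

(** Each [w] pays [phi z] to every neighbour [z] in [Z]. As no payment exceeds an equal share of
    [b w], the total stays within [b w]. *)
Lemma pay Z W (phi b : V -> nat) :
  (forall z w, z \in Z -> w \in W -> e z w -> phi z * #|N w :&: Z| <= b w) ->
  \sum_(z in Z) #|N z :&: W| * phi z <= \sum_(w in W) b w.
Proof.
move=> H; have -> : \sum_(z in Z) #|N z :&: W| * phi z =
    \sum_(w in W) \sum_(z in N w :&: Z) phi z.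
  under eq_bigr => z _ do rewrite card_nbI big_distrl /=.
  rewrite exchange_big; apply: eq_bigr => w _.
  rewrite [RHS](eq_bigl (fun z => (z \in Z) && e z w)); last first.
    by move=> z; rewrite !inE andbC e_sym.
  by rewrite [RHS]big_mkcondr; apply: eq_bigr => z _; case: (e z w); rewrite ?mul1n ?mul0n.
apply: leq_sum => w wW; apply: sum_share => z; rewrite !inE => /andP[ewz zZ].
by apply: H => //; rewrite e_sym.
Qed.

Lemma sole1 z W w : w \in W -> e z w -> #|N z :&: W| = 1 -> sole e z W w.
Proof.
move=> wW ezw /eqP/cards1P[u uE]; rewrite /sole uE.
have : w \in N z :&: W by rewrite !inE ezw.
by rewrite uE inE => /eqP->.
Qed.

Lemma clique_card S Z z : S \subset Z -> z \in S ->
  (forall z', z' \in S -> z != z' -> e z z') -> #|S| <= #|N z :&: Z|.+1.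
Proof.
move=> sS zS H; rewrite (cardsD1 z S) zS add1n ltnS; apply: subset_leq_card.
apply/subsetP => u; rewrite !inE => /andP[uz uS]; rewrite (subsetP sS) // andbT.
by apply: H => //; rewrite eq_sym.
Qed.

(** The marked vertices with only neighbour [w] form a clique, so each of them shares [w] only with
    neighbours in [Z]. With [r] of these, an equal part of [c] is at least [c %/ r.+1]. *)
Lemma pay_sole W Z (sp : pred V) c (b : V -> nat) :
  (forall z z' w, z \in Z -> z' \in Z -> z != z' -> sp z -> sp z' ->
     sole e z W w -> sole e z' W w -> e z z') ->
  (forall z w, z \in Z -> sp z -> sole e z W w -> c <= b w) ->
  \sum_(z in Z) (sp z && (#|N z :&: W| == 1)) * (c %/ #|N z :&: Z|.+1) <= \sum_(w in W) b w.
Proof.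
move=> cl Hc; pose F z := c %/ #|N z :&: Z|.+1.
apply: (@leq_trans (\sum_(w in W) \sum_(z in [set z in Z | sp z && sole e z W w]) F z)).
  have -> : \sum_(w in W) \sum_(z in [set z in Z | sp z && sole e z W w]) F z =
      \sum_(z in Z) \sum_(w in W) (sp z && sole e z W w) * F z.
    rewrite exchange_big; apply: eq_bigr => w _.
    rewrite (eq_bigl (fun z => (z \in Z) && (sp z && sole e z W w))); last by move=> z; rewrite inE.
    by rewrite big_mkcondr; apply: eq_bigr => z _; case: (_ && _); rewrite ?mul1n ?mul0n.
  apply: leq_sum => z zZ; case: (sp z) => //=.
  have [/cards1P[w wE]|] := boolP (#|N z :&: W| == 1) => //.
  have : w \in N z :&: W by rewrite wE set11.
  rewrite !inE => /andP[ezw wW]; rewrite (bigD1 w) //= /sole wE eqxx !mul1n.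
  exact: leq_addr.
apply: leq_sum => w wW; set S := [set _ in _ | _].
have sS : S \subset Z by apply/subsetP => u; rewrite inE => /andP[].
apply: sum_share => z; rewrite inE => /and3P[zZ spz so].
have le : #|S| <= #|N z :&: Z|.+1.
  apply: clique_card => // [|z']; first by rewrite inE zZ spz.
  by rewrite inE => /and3P[z'Z spz' so'] zz'; apply: (cl z z' w).
apply: leq_trans (Hc z w zZ spz so); apply: (@leq_trans (F z * #|N z :&: Z|.+1)).
  by rewrite leq_mul2l le orbT.
exact: leq_divM.
Qed.

Lemma card_cover x A : A = setT -> #|N x :&: A| = #|N x|.
Proof. by move=> ->; rewrite setIT. Qed.

(* In [discharge1] and [discharge2] every vertex of [Z] collects 12 half-edges: its own, counting
   those to earlier classes twice, and a share [phi] of what the last class can spare. The shares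
   are tight when the components are [K_7]. *)
Lemma discharge1 (V0 Z : {set V}) : [disjoint Z & V0] -> Z :|: V0 = setT ->
  (forall z, z \in Z -> ~~ free e z V0) ->
  (forall z w, z \in Z -> sole e z V0 w -> #|N w :&: Z| <= #|N z|) ->
  12 * #|Z| <= ends + 30 * #|V0|.
Proof.
move=> d cv nb0 dg.
pose r z := #|N z :&: Z|; pose d0 z := #|N z :&: V0|.
have dz z : r z + d0 z = #|N z| by rewrite -card_split // card_cover.
have d0z z : z \in Z -> 0 < d0 z by move=> /nb0 /card_nbI_gt0.
(* One share [10 - r] raises [r + 2] to 12; two shares of 4 raise [2 * 2] to 12. The budget 30 is
   the maximum of [(10 - r) * (r + 1)] for [r <= 5]. *)
pose phi z := if d0 z == 1 then 10 - r z else 4.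
have P : \sum_(z in Z) d0 z * phi z <= \sum_(w in V0) 30.
  apply: pay => z w zZ wV ezw; rewrite /phi; case: eqP => [d1|_].
    have := dg z w zZ (sole1 wV ezw d1); have := dz z; have := deg6 z; rewrite d1.
    move: (#|N w :&: Z|) (#|N z|) (r z) => X Y q h1 h2 h3.
    have {h1 h2 h3} [h1 h2] : q <= 5 /\ X <= q.+1 by lia.
    by move: h1 h2; do 6?[case: q => [|q]]; lia.
  by have := deg6 w; have := subset_leq_card (subsetIl (N w) Z); lia.
have Q : \sum_(z in Z) 12 <= \sum_(z in Z) (r z + 2 * d0 z + d0 z * phi z).
  apply: leq_sum => z zZ; have := d0z z zZ; have := dz z; have := deg6 z; rewrite /phi.
  by case: eqP => [->|]; [lia|nia].
rewrite !sum_nat_const in P Q; do 2!rewrite big_split /= in Q; rewrite !sumMl in Q.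
have := links_ends (Z :|: V0); rewrite linksUU // /links; move: P Q; rewrite /r /d0; clear; lia.
Qed.

Lemma discharge2 (V0 V1 Z : {set V}) : [disjoint Z & V0] -> [disjoint Z :|: V0 & V1] ->
  (Z :|: V0) :|: V1 = setT ->
  (forall z, z \in Z -> ~~ free e z V0) -> (forall z, z \in Z -> ~~ free e z V1) ->
  (forall z w, z \in Z -> sole e z V1 w -> ~~ free e w V0) ->
  (forall z w, z \in Z -> sole e z V1 w -> #|N w :&: Z| + 1 <= #|N z|) ->
  12 * #|Z| <= ends + 18 * #|V1|.
Proof.
move=> d d' cv nb0 nb1 bk dg.
pose r z := #|N z :&: Z|; pose d0 z := #|N z :&: V0|; pose d1 z := #|N z :&: V1|.
have dz z : r z + d0 z + d1 z = #|N z| by rewrite -!card_split // card_cover.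
have d0z z : z \in Z -> 0 < d0 z by move=> /nb0 /card_nbI_gt0.
have d1z z : z \in Z -> 0 < d1 z by move=> /nb1 /card_nbI_gt0.
(* Again the shares fill up to 12. An only neighbour has a neighbour in [V0] and so can pay
   [18 + 2 = 20], the maximum of [(9 - m) * m], where [m = d0 + r]; shares of 3 to six neighbours
   cost 18. *)
pose phi z := if d1 z == 1 then 10 - (r z + 2 * d0 z) else 3.
have P : \sum_(z in Z) d1 z * phi z <= \sum_(w in V1) (18 + 2 * d0 w).
  apply: pay => z w zZ wV ezw; rewrite /phi; case: eqP => [s1|_].
    have so := sole1 wV ezw s1.
    have := card_nbI_gt0 (bk z w zZ so); rewrite -/(d0 w).
    have := dg z w zZ so; have := dz z; have := deg6 z; have := d0z z zZ; rewrite s1.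
    move: (#|N w :&: Z|) (#|N z|) (r z) (d0 z) (d0 w) => X Y q d0' d0w h0 h1 h2 h3 h4.
    have {h1 h2 h3} [h1 h2] : d0' + q <= 5 /\ X <= d0' + q by lia.
    apply: (@leq_trans 20); last by lia.
    have [le|] := leqP 10 (q + 2 * d0'); first by have -> : 10 - (q + 2 * d0') = 0 by lia.
    have le9 : 10 - (q + 2 * d0') <= 9 - (d0' + q) by lia.
    move: h1 h2 le9; move: (10 - _) (d0' + q) => a m h1 h2 h3 _.
    have : a * X <= (9 - m) * m by apply: leq_mul.
    by move: h1; clear; do 6?[case: m => [|m]]; lia.
  by have := deg6 w; have := subset_leq_card (subsetIl (N w) Z); lia.
have Q : \sum_(z in Z) 12 <= \sum_(z in Z) (r z + 2 * d0 z + 2 * d1 z + d1 z * phi z).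
  apply: leq_sum => z zZ; have := d0z z zZ; have := d1z z zZ; rewrite /phi.
  by case: eqP => [->|]; [lia|nia].
rewrite sum_nat_const in Q; do 3!rewrite big_split /= in Q.
rewrite big_split /= sum_nat_const in P; rewrite !sumMl in P Q.
have := links_ends ((Z :|: V0) :|: V1); rewrite !linksUU // linksUl // [links V0 V1]links_sym /links.
by move: P Q; rewrite /r /d0 /d1; clear; lia.
Qed.

(** Each half-edge now counts 12. Edges from [V2] to earlier classes enlarge what [V2] can pay;
    edges from [V1] to [V0] are credited to vertices with a single neighbour in [V1]. The predicate
    [sp] marks vertices for which the clique property at [V1] is available. *)
Lemma discharge3 (V0 V1 V2 Z : {set V}) (sp : pred V) :
  [disjoint Z & V0] -> [disjoint Z :|: V0 & V1] -> [disjoint (Z :|: V0) :|: V1 & V2] ->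
  ((Z :|: V0) :|: V1) :|: V2 = setT ->
  (forall z W, z \in Z -> W \in [:: V2; V1; V0] -> ~~ free e z W) ->
  (forall z w, z \in Z -> sole e z V1 w -> ~~ free e w V0) ->
  (forall z w, z \in Z -> sole e z V2 w -> ~~ free e w V0 /\ ~~ free e w V1) ->
  (forall z w, z \in Z -> sole e z V2 w -> #|N w :&: Z| + 2 <= #|N z|) ->
  (forall z z' w, z \in Z -> z' \in Z -> z != z' -> sp z -> sp z' ->
     sole e z V1 w -> sole e z' V1 w -> e z z') ->
  (forall z, z \in Z -> (forall W, W \in [:: V2; V1; V0] -> #|N z :&: W| = 1) -> sp z) ->
  (forall z, z \in Z -> sp z) \/ (forall y, y \in V2 -> ~~ free e y V0) ->
  162 * #|Z| <= 12 * ends + 144 * #|V2|.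
Proof.
move=> dj0 dj1 dj2 cv nbZ bk1 bk2 dg cl spall AB.
pose r z := #|N z :&: Z|; pose d0 z := #|N z :&: V0|; pose d1 z := #|N z :&: V1|.
pose d2 z := #|N z :&: V2|.
have dz z : r z + d0 z + d1 z + d2 z = #|N z| by rewrite -!card_split // card_cover.
have d0z z : z \in Z -> 0 < d0 z.
  by move=> zZ; apply: card_nbI_gt0; apply: nbZ => //; rewrite !inE eqxx !orbT.
have d1z z : z \in Z -> 0 < d1 z.
  by move=> zZ; apply: card_nbI_gt0; apply: nbZ => //; rewrite !inE eqxx !orbT.
have d2z z : z \in Z -> 0 < d2 z.
  by move=> zZ; apply: card_nbI_gt0; apply: nbZ => //; rewrite !inE eqxx.
(* The share from each of several neighbours in [V2]: 24 is a sixth of 144. If the vertices of [V2]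
   have neighbours in [V0], each has at most five in [Z] and can pay 168, which allows 33. With 24,
   the deficit of a vertex with only two neighbours in [V2] is covered through [psi], hence the need
   for [sp]. *)
have [k Hk] : exists k, (k = 24 /\ forall z, z \in Z -> sp z) \/
    (k = 33 /\ forall y, y \in V2 -> 0 < d0 y).
  case: AB => AB; first by exists 24; left.
  by exists 33; right; split=> // y yV; apply: card_nbI_gt0; apply: AB.
(* An only neighbour in [V2] sees both earlier classes and can pay [144 + 24 + 24 = 192]; by the
   degree hypothesis it has at most [d0 + d1 + r - 1] neighbours in [Z]. *)
pose phi z := if d2 z == 1 then 192 %/ (d0 z + d1 z + r z).-1 else k.
pose psi z := (sp z && (d1 z == 1)) * (24 %/ (r z).+1).
have P2 : \sum_(z in Z) d2 z * phi z <= \sum_(w in V2) (144 + 24 * d0 w + 24 * d1 w).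
  apply: pay => z w zZ wV ezw; have dw := dz w; have g6 := deg6 w.
  rewrite /phi; case: eqP => [s2|_].
    have so := sole1 wV ezw s2; have [f0 f1] := bk2 z w zZ so.
    have := dg z w zZ so; have := dz z; have := d0z z zZ; have := d1z z zZ; rewrite s2.
    have := card_nbI_gt0 f0; have := card_nbI_gt0 f1; rewrite -/(d0 w) -/(d1 w) -/(r w).
    move: (r z) (d0 z) (d1 z) (#|N z|) (r w) (d0 w) (d1 w); clear.
    move=> rz d0z d1z nz rw d0w d1w h1 h2 h3 h4 h5 h6; apply: (@leq_trans 192); last by lia.
    apply: leq_trans (leq_divM 192 (d0z + d1z + rz).-1).
    by rewrite leq_mul2l; apply/orP; right; lia.
  rewrite -/(r w); case: Hk => [[-> _]|[-> H]]; first by lia.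
  by have := H w wV; lia.
have P1 : \sum_(z in Z) psi z <= \sum_(w in V1) 24 * d0 w.
  apply: pay_sole => // z w zZ _ so; have := card_nbI_gt0 (bk1 z w zZ so).
  by rewrite -/(d0 w); lia.
have Q : \sum_(z in Z) 162 <=
    \sum_(z in Z) (12 * r z + 24 * d0 z + 24 * d1 z + 24 * d2 z + d2 z * phi z + psi z).
  apply: leq_sum => z zZ; have := d0z z zZ; have := d1z z zZ; have := d2z z zZ.
  have := dz z; have := deg6 z; rewrite /phi /psi.
  have sp1 : d0 z = 1 -> d1 z = 1 -> d2 z = 1 -> sp z.
    move=> h0 h1 h2; apply: spall => // W; rewrite !inE => /or3P[] /eqP-> //.
  have sp2 : k = 33 \/ sp z by case: Hk => [[_ H]|[-> _]]; [right; apply: H|left].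
  have k24 : 24 <= k by case: Hk => [[-> _]|[-> _]].
  move: sp1 sp2 k24; clear; move: (r z) (d0 z) (d1 z) (d2 z) (sp z) => q a b c s sp1 sp2 k24.
  move=> /= h6 E hc hb ha; have {E} h6 : q + a + b + c <= 6 by lia.
  case: eqP => [c1|c1].
    subst c; have [m1 m2] : 0 < a + b + q - 1 /\ a + b + q - 1 <= 4 by lia.
    have [x0|x0] := eqVneq (a + b) 2.
      have [a1 b1] : a = 1 /\ b = 1 by lia.
      subst a b; rewrite sp1 // eqxx /=.
      by move: h6; clear; do 4?[case: q => [|q] //]; lia.
    apply: leq_trans (leq_addr _ _).
    have : 192 %/ 4 <= 192 %/ (a + b + q).-1 by apply: leq_div2l; lia.
    rewrite (_ : 192 %/ 4 = 48) // => le48; have [q2|q2] := leqP 2 q.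
      by move: (192 %/ _) le48 => X le48; lia.
    have [x1|x1] := eqVneq (a + b + q) 3.
      by rewrite x1 (_ : 192 %/ 3.-1 = 96) //; lia.
    have [x2|x2] := eqVneq (a + b + q) 4.
      by rewrite x2 (_ : 192 %/ 4.-1 = 64) //; lia.
    by move: (192 %/ _) le48 => X le48; lia.
  have [x0|x0] := leqP 5 (a + b + c); first by apply: leq_trans (leq_addr _ _); nia.
  have [c2 [a1 b1]] : c = 2 /\ a = 1 /\ b = 1 by lia.
  subst a b c; case: sp2 => [k33|->]; first by apply: leq_trans (leq_addr _ _); lia.
  rewrite /=; move: h6 k24; clear; case: q => [|[|q]] h6 k24.
  - by rewrite divn1; lia.
  - by rewrite (_ : 24 %/ 2 = 12) //; lia.
  - by apply: leq_trans (leq_addr _ _); lia.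
rewrite sum_nat_const in Q; do 5!rewrite big_split /= in Q.
do 2!rewrite big_split /= in P2; rewrite sum_nat_const in P2; rewrite !sumMl in P1 P2 Q.
have := links_ends (((Z :|: V0) :|: V1) :|: V2).
rewrite !linksUU // !linksUl // [links V0 V1]links_sym [links V0 V2]links_sym [links V1 V2]links_sym /links.
by move: P1 P2 Q; rewrite /r /d0 /d1 /d2; clear; lia.
Qed.


(** * Discharging with four accessible classes *)

Section FourClasses.
Variables V0 V1 V2 V3 R : {set V}.

(** With four classes no further one is sought, so every vertex of the rest [R] can be spared and
    the exchange properties hold for all of them. [V3] is the latest class. *)
Record four_classes : Prop := FourClasses {
  four_disj : [&& [disjoint R & V0], [disjoint R :|: V0 & V1], [disjoint (R :|: V0) :|: V1 & V2]
                & [disjoint ((R :|: V0) :|: V1) :|: V2 & V3]];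
  four_nb : forall z W, z \in R -> W \in [:: V3; V2; V1; V0] -> ~~ free e z W;
  four_back1 : forall z w, z \in R -> sole e z V1 w -> ~~ free e w V0;
  four_back2 : forall z w, z \in R -> sole e z V2 w -> ~~ free e w V0 /\ ~~ free e w V1;
  four_back3 : forall z w, z \in R -> sole e z V3 w ->
    [/\ ~~ free e w V0, ~~ free e w V1 & ~~ free e w V2];
  four_clique : forall W z z' w, W \in [:: V3; V2; V1] -> z \in R -> z' \in R -> z != z' ->
    sole e z W w -> sole e z' W w -> e z z' }.

(* A vertex with [r] neighbours in [R] and [a], [b], [c], [d] in the classes also receives a share of
   the edges that its only neighbour in [V1] or [V2] sends to earlier classes; that neighbour is
   shared with at most [r] other vertices. *)
Definition weight (r a b c d : nat) :=
  6 * r + 12 * (a + b + c + d) + (b == 1) * (12 %/ r.+1) + (c == 1) * (24 %/ r.+1).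

Definition total_weight k :=
  \sum_(z in R) (weight #|N z :&: R| #|N z :&: V0| #|N z :&: V1| #|N z :&: V2| #|N z :&: V3| +
                 (#|N z :&: V3| == 1) * (k %/ #|N z :&: R|.+1)).

Hypothesis four : four_classes.

Lemma four_deg z : z \in R -> [/\ 0 < #|N z :&: V0|, 0 < #|N z :&: V1|, 0 < #|N z :&: V2|,
  0 < #|N z :&: V3| &
  #|N z :&: R| + #|N z :&: V0| + #|N z :&: V1| + #|N z :&: V2| + #|N z :&: V3| <= 6].
Proof.
move=> zR; have H W : W \in [:: V3; V2; V1; V0] -> 0 < #|N z :&: W|.
  by move=> WL; apply: card_nbI_gt0; apply: four_nb.
split; try by apply: H; rewrite !inE eqxx ?orbT.
case: four => /and4P[h0 h1 h2 h3] *.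
by rewrite -!card_split //; apply: leq_trans (deg6 z); apply: subset_leq_card; apply: subsetIl.
Qed.

(** A half-edge counts 6. An only neighbour in [V3] sends edges to all three earlier classes, worth
    at least 36: [k] is divided among the vertices of [R] that share it, and every vertex of [V3]
    keeps [m]. *)
Lemma total_weight_le (k m : nat) :
  (forall w, w \in V3 -> m <= 12 * (#|N w :&: V0| + #|N w :&: V1| + #|N w :&: V2|)) ->
  k + m <= 36 ->
  total_weight k + m * #|V3| <= 6 * ends.
Proof.
move=> Hm Hk; case: four => /and4P[h0 h1 h2 h3] _ bk1 bk2 bk3 cl.
pose b1 w := 12 * #|N w :&: V0|.
pose b2 w := 12 * (#|N w :&: V0| + #|N w :&: V1|).
pose b3 w := 12 * (#|N w :&: V0| + #|N w :&: V1| + #|N w :&: V2|) - m.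
have cl' W : W \in [:: V3; V2; V1] -> forall z z' w, z \in R -> z' \in R -> z != z' ->
    xpredT z -> xpredT z' -> sole e z W w -> sole e z' W w -> e z z'.
  by move=> WL z z' w zR z'R zz' _ _; apply: cl WL zR z'R zz'.
have P1 := @pay_sole V1 R xpredT 12 b1 (cl' V1 _) _.
have {}P1 := P1 ltac:(by rewrite !inE eqxx !orbT).
have {P1} /P1 P1 : forall z w, z \in R -> xpredT z -> sole e z V1 w -> 12 <= b1 w.
  by move=> z w zR _ so; have := card_nbI_gt0 (bk1 z w zR so); rewrite /b1; clear; lia.
have P2 := @pay_sole V2 R xpredT 24 b2 (cl' V2 _) _.
have {}P2 := P2 ltac:(by rewrite !inE eqxx !orbT).
have {P2} /P2 P2 : forall z w, z \in R -> xpredT z -> sole e z V2 w -> 24 <= b2 w.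
  move=> z w zR _ so; have [f0 f1] := bk2 z w zR so; rewrite /b2.
  by have := card_nbI_gt0 f0; have := card_nbI_gt0 f1; clear; lia.
have P3 := @pay_sole V3 R xpredT k b3 (cl' V3 _) _.
have {}P3 := P3 ltac:(by rewrite !inE eqxx ?orbT).
have {P3} /P3 P3 : forall z w, z \in R -> xpredT z -> sole e z V3 w -> k <= b3 w.
  move=> z w zR _ so; have [f0 f1 f2] := bk3 z w zR so; rewrite /b3.
  have := card_nbI_gt0 f0; have := card_nbI_gt0 f1; have := card_nbI_gt0 f2.
  by move: Hk; clear; lia.
have E3 : \sum_(w in V3) b3 w + m * #|V3| = 12 * (links V3 V0 + links V3 V1 + links V3 V2).
  rewrite mulnC -sum_nat_const -big_split /= /links -!big_split /= big_distrr /=.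
  by apply: eq_bigr => w wV; rewrite /b3 subnK // Hm.
have E2 : \sum_(w in V2) b2 w = 12 * (links V2 V0 + links V2 V1).
  by rewrite /links -big_split /= big_distrr.
have E1 : \sum_(w in V1) b1 w = 12 * links V1 V0 by rewrite big_distrr.
have := links_ends ((((R :|: V0) :|: V1) :|: V2) :|: V3).
rewrite !linksUU // !linksUl // [links V0 V1]links_sym [links V0 V2]links_sym [links V1 V2]links_sym.
rewrite [links V0 V3]links_sym [links V1 V3]links_sym [links V2 V3]links_sym.
rewrite /total_weight /weight; do 4!rewrite big_split /=; rewrite sumMl sumMl.
do 3!rewrite [\sum_(i in R) (_ + _)]big_split /=.
rewrite /links in E1 E2 E3 *; move: P1 P2 P3 E1 E2 E3; clear => /=; lia.
Qed.

End FourClasses.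

(** The value 80 is attained at [r = 2] and [a = b = c = d = 1], the degrees found in a [K_7]. *)
Lemma weight_bound r a b c d : 0 < a -> 0 < b -> 0 < c -> 0 < d -> r + a + b + c + d <= 6 ->
  80 <= weight r a b c d + (d == 1) * (24 %/ r.+1).
Proof.
rewrite /weight => ha hb hc hd; case: r => [|[|[|r]]] h; last by lia.
- by rewrite -[24 %/ 1]/24 -[12 %/ 1]/12; do 3![case: eqP => ?]; lia.
- by rewrite -[24 %/ 2]/12 -[12 %/ 2]/6; do 3![case: eqP => ?]; lia.
- by rewrite -[24 %/ 3]/8 -[12 %/ 3]/4; do 3![case: eqP => ?]; lia.
Qed.

Lemma weight_tight r a b c d : 0 < a -> 0 < b -> 0 < c -> 0 < d -> r + a + b + c + d <= 6 ->
  84 <= weight r a b c d + (d == 1) * (36 %/ r.+1) /\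
  (weight r a b c d + (d == 1) * (36 %/ r.+1) <= 84 ->
   r = 2 \/ 1 < d /\ (r = 1 \/ b = 1 /\ 1 < c)).
Proof.
rewrite /weight => ha hb hc hd; case: r => [|[|[|r]]] h; last by lia.
- by rewrite -[36 %/ 1]/36 -[24 %/ 1]/24 -[12 %/ 1]/12; do 3![case: eqP => ?]; lia.
- by rewrite -[36 %/ 2]/18 -[24 %/ 2]/12 -[12 %/ 2]/6; do 3![case: eqP => ?]; lia.
- by rewrite -[36 %/ 3]/12 -[24 %/ 3]/8 -[12 %/ 3]/4; do 3![case: eqP => ?]; lia.
Qed.

(** Since each vertex of [V3] sees [V0], it can keep 12, while [k = 24] still gives weight 80 to
    each vertex of [R]. The retained [12 * p] outweighs the missing [4 * #|R|]. *)
Lemma four_strict (V0 V1 V2 V3 R : {set V}) p : four_classes V0 V1 V2 V3 R ->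
  (forall y, y \in V3 -> ~~ free e y V0) -> #|V3| = p -> #|R| < 3 * p -> 14 * #|R| < ends.
Proof.
move=> four S cV lt.
have H : total_weight V0 V1 V2 V3 R 24 + 12 * #|V3| <= 6 * ends.
  apply: (total_weight_le four) => // w wV.
  by have := card_nbI_gt0 (S w wV); clear; lia.
have : \sum_(z in R) 80 <= total_weight V0 V1 V2 V3 R 24.
  by apply: leq_sum => z /(four_deg four)[]; apply: weight_bound.
by rewrite sum_nat_const; move: H lt; rewrite cV; clear; lia.
Qed.

(* The second alternative is excluded later by also applying this to the classes in another order. *)
Lemma four_tight (V0 V1 V2 V3 R : {set V}) : four_classes V0 V1 V2 V3 R -> ends <= 14 * #|R| ->
  forall z, z \in R -> #|N z :&: R| = 2 \/
    1 < #|N z :&: V3| /\ (#|N z :&: R| = 1 \/ #|N z :&: V1| = 1 /\ 1 < #|N z :&: V2|).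
Proof.
move=> four le z zR.
have H : total_weight V0 V1 V2 V3 R 36 + 0 * #|V3| <= 6 * ends.
  exact: (total_weight_le four).
have T y : y \in R -> _ := fun yR => let: And5 h0 h1 h2 h3 h4 := four_deg four yR in
  weight_tight h0 h1 h2 h3 h4.
apply: (T z zR).2; move: H; rewrite /total_weight (big_setD1 z) //=.
set X := (X in X + _ + _ <= _ -> _) => H.
have : \sum_(y in R :\ z) 84 <= \sum_(y in R :\ z)
   (weight #|N y :&: R| #|N y :&: V0| #|N y :&: V1| #|N y :&: V2| #|N y :&: V3| +
                 (#|N y :&: V3| == 1) * (36 %/ #|N y :&: R|.+1)).
  by apply: leq_sum => y; rewrite !inE => /andP[_ /T[]].
by rewrite sum_nat_const; have := cardsD1 z R; rewrite zR; move: H le; clear; lia.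
Qed.

End Discharging.

(** * Repeated accessibility structures *)

Section Systems.
Variables (V : finType) (e : rel V) (p s : nat).
Hypotheses (e_sym : symmetric e) (e_irr : irreflexive e) (p_gt0 : 0 < p).
Hypotheses (deg6 : forall x, #|nb e x| <= 6) (s_lt : s < 3 * p).
Implicit Types (A B U W X Z g : {set V}) (L M : seq {set V}) (x y z w : V).

Local Notation "'N' x" := (nb e x) (at level 10, x at level 8).

Lemma count_classes x Z L : pairwise (fun A B => [disjoint A & B]) (Z :: L) ->
  (forall X, X \in L -> ~~ free e x X) -> #|N x :&: Z| + size L <= #|N x :&: (Z :|: cov L)|.
Proof.
elim: L Z => [|X L IH] Z; first by rewrite /= setU0 addn0.
rewrite pairwise_cons => /andP[/= /andP[dZX dZL] /andP[dXL dL]] H.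
have fX := card_nbI_gt0 (H X (mem_head _ _)).
have := IH (Z :|: X); rewrite setUA card_split // => IH'.
apply: leq_trans (IH' _ _); first by move: fX; clear => /=; lia.
- rewrite pairwise_cons dL andbT; apply/allP => Y YL.
  by rewrite disjUl (allP dZL) // (allP dXL).
- by move=> Y YL; apply: H; rewrite inE YL orbT.
Qed.

Lemma chain_cov_card g L : chain e p g L -> #|cov L|.+1 = size L * p + #|g|.
Proof.
elim: L => // W L IH; have [->|L0] := eqVneq L [::].
  case/and3P => gW _ /eqP c; rewrite /= setU0 mul1n.
  have := cardsD W g; rewrite c (setIidPr gW); have := subset_leq_card gW.
  by move: p_gt0; clear; lia.
case/chain_consP => // _ c d _ /IH; rewrite /= cardsU (disjoint_setI0 d) cards0 c.
by clear; lia.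
Qed.

Lemma chain_card1 g L W : #|g| = 1 -> chain e p g L -> W \in L -> #|W| = p.
Proof.
move=> g1; elim: L => // X L IH; have [->|L0] := eqVneq L [::].
  case/and3P => gW _ /eqP c; rewrite mem_seq1 => /eqP->.
  have := cardsD X g; rewrite c (setIidPr gW) g1; have := subset_leq_card gW; rewrite g1.
  by move: p_gt0; clear; lia.
case/chain_consP => // _ c _ _ ch; rewrite inE => /orP[/eqP->//|]; exact: IH.
Qed.

(** The state of the nested construction: [L] collects the classes of all levels, and [k] more are
    expected in [Z], which has [s] vertices in excess. [sys_deg] records the least degree sum; the
    last two fields are what the discharging with three and with four classes asks for. *)
Record sys L Z k : Prop := Sys {
  sys_core : core e p L Z k;
  sys_size : size L + k = 4;
  sys_nil : L != [::];
  sys_cov : Z :|: cov L = setT;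
  sys_card : forall W, W \in L -> #|W| <= p;
  sys_rest : #|Z| = k * p + s;
  sys_good : good e p k Z;
  sys_deg : forall W L2 z w, L = W :: L2 -> z \in Z -> good e p k (Z :\ z) -> sole e z W w ->
    #|N w :&: Z| + size L2 <= #|N z|;
  sys_three : forall A B C, L = [:: C; B; A] -> (forall y, y \in C -> ~~ free e y A) \/
    (forall z z' w, z \in Z -> z' \in Z -> z != z' -> good e p k (Z :\ z) ->
       sole e z B w -> sole e z' B w -> e z z');
  sys_four : size L = 4 -> #|head set0 L| = p /\
    forall y, y \in head set0 L -> ~~ free e y (last set0 L) }.

(** Optimality compares degrees inside [U] only. Outside [U], [z] has a neighbour in each outer
    class; inside, [w] has one in each earlier class of its own level. The two gains add up. *)
Lemma level_deg L U c g W L2 z w : core e p L U c ->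
  core e p ((W :: L2) ++ L) (U :\: cov (W :: L2)) (c - size (W :: L2)) ->
  ~~ good e p c (U :\: g) -> optimal e p U c g (W :: L2) ->
  z \in U :\: cov (W :: L2) -> good e p (c - size (W :: L2)) ((U :\: cov (W :: L2)) :\ z) ->
  sole e z W w -> #|N w :&: (U :\: cov (W :: L2))| + size (L2 ++ L) <= #|N z|.
Proof.
move=> co co' bad op zZ gz so; have := optimal_deg e_sym e_irr p_gt0 bad op zZ gz so.
have [[_ sL _ _] _] := op.1.
have zU : z \in U by move: zZ; rewrite inE => /andP[].
have le1 : #|N z :&: U| + size L <= #|N z|.
  apply: leq_trans (subset_leq_card (subsetIl (N z) (U :|: cov L))).
  by apply: count_classes (core_disj co) _ => X XL; apply: core_nb co _ _ zU XL.
have le2 : #|N w :&: (U :\: cov (W :: L2))| + size L2 <= #|N w :&: U|.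
  apply: leq_trans (_ : #|N w :&: ((U :\: cov (W :: L2)) :|: cov L2)| <= _).
    apply: count_classes => [|X XL].
      apply: subseq_pairwise (core_disj co'); apply: (cat_subseq (subseq_refl [:: _])).
      exact: subseq_trans (prefix_subseq _ L) (subseq_cons _ _).
    apply: (core_back co' (L1 := [::]) (erefl _) zZ gz so); by rewrite mem_cat XL.
  apply: subset_leq_card; apply: setIS; rewrite subUset subsetDl /=.
  by apply: subset_trans sL; apply: subsetUr.
by rewrite size_cat; move: le1 le2; clear; lia.
Qed.

(** If [z0] cannot be spared, [Z] without [z0] is again an unsolvable instance. Its first root is
    the class of the packing that contains [z0], with [z0] as the ghost. *)
Lemma sys_extend L Z k z0 : sys L Z k -> z0 \in Z -> ~~ good e p k (Z :\ z0) ->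
  exists L' Z' k', k' < k /\ sys L' Z' k'.
Proof.
move=> sy z0Z bad; case: (good_split (sys_good sy) z0Z) => [gz|[k1 [kE [B [zB sB iB cB gB]]]]].
  by rewrite gz in bad.
have lv0 : lv e p Z k [set z0] [:: B].
  split; rewrite ?[cov _]/= ?setU0 //; last 2 first.
  - by rewrite kE.
  - by rewrite kE subn1.
  rewrite /= sub1set zB iB /=; apply/eqP.
  by have := cardsD1 z0 B; rewrite zB cB => ->.
have [L' op] := optimal_exists lv0; have [lo _] := op; have [ch sL sc gZ] := lo.1.
have g1 : #|[set z0]| = 1 by rewrite cards1.
have co := sys_core sy.
have co' := core_extend e_sym e_irr p_gt0 co (or_intror g1) bad lo.
have L'0 : L' != [::] by case: (L') ch.
have szL' : 0 < size L' by case: (L') L'0.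
exists (L' ++ L), (Z :\: cov L'), (k - size L'); split; first by move: szL' sc; clear; lia.
have hd : head set0 (L' ++ L) \in L' by case: (L') L'0 => //= X M _; rewrite mem_head.
have ls : last set0 (L' ++ L) \in L.
  by have := sys_nil sy; case/lastP: (L) => // M X _; rewrite last_cat last_rcons mem_rcons mem_head.
(* The latest class now lies in the former [Z], so each of its vertices has a neighbour in the
   outermost root. This settles the last two fields. *)
have nbl y : y \in head set0 (L' ++ L) -> ~~ free e y (last set0 (L' ++ L)).
  by move=> yH; apply: (core_nb co _ ls); apply: (subsetP sL); apply: (subsetP (cov_sup hd)).
split=> //.
- by rewrite size_cat; have := sys_size sy; move: sc; clear; lia.
- by case: (L') L'0.
- rewrite cov_cat -(sys_cov sy); apply/setP => u; move: (subP sL u); rewrite !inE.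
  by bsolve.
- move=> W; rewrite mem_cat => /orP[WL|WL]; last exact: sys_card sy _ WL.
  by rewrite (chain_card1 g1 ch WL).
- have := chain_cov_card ch; rewrite g1 cardsD (setIidPr sL) (sys_rest sy).
  by move: sc; rewrite mulnBl; clear; nia.
- move=> W L2 z w LE zZ gz so; case L'E: L' L'0 => [//|W' L2'] _; rewrite L'E in LE zZ gz co' op *.
  case: LE => WE <-; rewrite -WE in so; exact: level_deg co co' bad op zZ gz so.
- by move=> A B' C LE; left => y yC; move: (nbl y); rewrite LE /=; apply.
- by move=> _; split=> //; apply: chain_card1 g1 ch hd.
Qed.

(** From [#|Z| = 3 * p + s] and [#|A| <= p] one gets at least [6 * p + 12 * s] ends, more than
    [14 * s] since [s < 3 * p]. The constants for two and three classes are balanced in the same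
    way. *)
Lemma sys_strict1 Z A : sys [:: A] Z 3 -> (forall z, z \in Z -> good e p 3 (Z :\ z)) ->
  14 * s < ends e.
Proof.
move=> sy sp; have co := sys_core sy; have := core_disj co; rewrite /= !andbT => dj.
have := sys_card sy (mem_head _ _); have := sys_rest sy.
have : 12 * #|Z| <= ends e + 30 * #|A|; last by move: s_lt; clear; lia.
apply: discharge1 => //.
- by rewrite -(sys_cov sy) /= setU0.
- by move=> z zZ; apply: (core_nb co zZ); rewrite inE.
- move=> z w zZ so; have := sys_deg sy (erefl _) zZ (sp z zZ) so.
  by rewrite /= addn0.
Qed.

Lemma sys_strict2 Z A B : sys [:: B; A] Z 2 -> (forall z, z \in Z -> good e p 2 (Z :\ z)) ->
  14 * s < ends e.
Proof.
move=> sy sp; have co := sys_core sy.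
have := core_disj co; rewrite /= !andbT -!andbA => /and3P[dZB dZA dBA].
have := sys_card sy (mem_head _ _); have := sys_rest sy.
have : 12 * #|Z| <= ends e + 18 * #|B|; last by move: s_lt; clear; lia.
apply: (@discharge2 _ _ e_sym deg6 A B) => //.
- by rewrite disjUl dZB disjoint_sym.
- by rewrite -(sys_cov sy) /= setU0 -setUA [A :|: B]setUC.
- by move=> z zZ; apply: (core_nb co zZ); rewrite !inE eqxx orbT.
- by move=> z zZ; apply: (core_nb co zZ); rewrite !inE eqxx.
- move=> z w zZ so.
  by apply: (core_back co (L1 := [::]) (erefl _) zZ (sp z zZ) so); rewrite inE.
- by move=> z w zZ so; apply: (sys_deg sy (erefl _) zZ (sp z zZ) so).
Qed.

Lemma sys_strict3 Z A B C : sys [:: C; B; A] Z 1 -> (forall z, z \in Z -> good e p 1 (Z :\ z)) ->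
  14 * s < ends e.
Proof.
move=> sy sp; have co := sys_core sy.
have := core_disj co; rewrite /= !andbT -!andbA => /and5P[dZC dZB dZA dCB /andP[dCA dBA]].
have := sys_card sy (mem_head _ _); have := sys_rest sy.
have : 162 * #|Z| <= 12 * ends e + 144 * #|C|; last by move: s_lt; clear; lia.
have bk L1 W L2 z w X : [:: C; B; A] = L1 ++ W :: L2 -> z \in Z -> sole e z W w -> X \in L2 ->
    ~~ free e w X.
  by move=> LE zZ so XL; apply: (core_back co LE zZ (sp z zZ) so XL).
(* If all vertices of [C] see [A], the clique property is taken only for vertices with one neighbour
   in every class, from [core_clique0]; in the other case it holds on all of [Z]. *)
pose allsole z := all (fun W => #|N z :&: W| == 1) [:: C; B; A].
have [sp1 [cl1 [al1 AB1]]] : exists sp1 : pred V,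
    (forall z z' w, z \in Z -> z' \in Z -> z != z' -> sp1 z -> sp1 z' ->
       sole e z B w -> sole e z' B w -> e z z') /\
    (forall z, z \in Z -> allsole z -> sp1 z) /\
    ((forall z, z \in Z -> sp1 z) \/ (forall y, y \in C -> ~~ free e y A)).
  case: (sys_three sy (erefl _)) => H; [exists allsole | exists xpredT]; last first.
    by split; [move=> z z' w zZ z'Z zz' _ _; apply: H zZ z'Z zz' (sp z zZ) | split=> //; left].
  split; [move=> z z' w zZ z'Z zz' al _ | by split=> //; right].
  apply: (core_clique0 co _ zZ z'Z zz' (sp z zZ)); first by rewrite !inE eqxx orbT.
  by move=> X XL; have /cards1P[y yE] := allP al X XL; exists y; apply/eqP.
apply: (@discharge3 _ _ e_sym deg6 A B C Z sp1) => //.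
- by rewrite disjUl dZB disjoint_sym.
- by rewrite !disjUl dZC disjoint_sym dCA disjoint_sym.
- rewrite -(sys_cov sy) /= setU0; apply/setP => u; rewrite !inE; bsolve.
- by move=> z W zZ; apply: (core_nb co zZ).
- by move=> z w zZ so; apply: (bk [:: C] B [:: A]) so _ => //; rewrite inE.
- move=> z w zZ so; split; apply: (bk [::] C [:: B; A]) so _ => //; by rewrite !inE eqxx ?orbT.
- by move=> z w zZ so; apply: (sys_deg sy (erefl _) zZ (sp z zZ) so).
- by move=> z zZ H; apply: al1 => //; apply/allP => W WL; rewrite H.
Qed.

Lemma core_four Z A B C D : core e p [:: D; C; B; A] Z 0 -> four_classes e A B C D Z.
Proof.
move=> co; have := core_disj co; rewrite /= !andbT -!andbA.
case/and5P=> dZD dZC dZB dZA /and5P[dDC dDB dDA dCB /andP[dCA dBA]].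
have bk L1 W L2 z w X : [:: D; C; B; A] = L1 ++ W :: L2 -> z \in Z -> sole e z W w -> X \in L2 ->
    ~~ free e w X.
  by move=> LE zZ so XL; apply: (core_back co LE zZ isT so XL).
split.
- rewrite !disjUl dZA dZB dZC dZD [[disjoint A & B]]disjoint_sym dBA /=.
  rewrite [[disjoint A & C]]disjoint_sym dCA [[disjoint B & C]]disjoint_sym dCB /=.
  by rewrite [[disjoint A & D]]disjoint_sym dDA [[disjoint B & D]]disjoint_sym dDB disjoint_sym dDC.
- by move=> z W zZ; apply: (core_nb co zZ).
- by move=> z w zZ so; apply: (bk [:: D; C] B [:: A]) so _ => //; rewrite inE.
- by move=> z w zZ so; split; apply: (bk [:: D] C [:: B; A]) so _ => //; rewrite !inE eqxx ?orbT.
- by move=> z w zZ so; split; apply: (bk [::] D [:: C; B; A]) so _ => //; rewrite !inE eqxx ?orbT.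
- move=> W z z' w WL zZ z'Z zz'; apply: (core_clique co _ zZ z'Z zz' isT).
  by move: WL; rewrite !inE => /or3P[] -> //; rewrite ?orbT.
Qed.

(** Induction on [k]: a vertex that cannot be spared opens a further level; once all can be spared,
    the discharging for the present number of classes applies. *)
Lemma sys_strict L Z k : sys L Z k -> 14 * s < ends e.
Proof.
have [n le] := ubnP k; elim: n k le L Z => // n IH k; rewrite ltnS => le L Z sy.
case: (boolP [forall z in Z, good e p k (Z :\ z)]) => [/forall_inP sp|]; last first.
  rewrite negb_forall_in => /exists_inP[z0 z0Z bad].
  have [L' [Z' [k' [lt sy']]]] := sys_extend sy z0Z bad.
  by apply: (IH k' _ L' Z' sy'); apply: leq_trans lt le.
have := sys_size sy; have := sys_nil sy; case: L sy => [|A [|B [|C [|D [|E L]]]]] sy //= _ sz.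
- have k3 : k = 3 by move: sz; clear; lia.
  by rewrite k3 in sy sp; apply: sys_strict1 sy sp.
- have k2 : k = 2 by move: sz; clear; lia.
  by rewrite k2 in sy sp; apply: sys_strict2 sy sp.
- have k1 : k = 1 by move: sz; clear; lia.
  by rewrite k1 in sy sp; apply: sys_strict3 sy sp.
have k0 : k = 0 by move: sz; clear; lia.
rewrite k0 in sy; have [cA nbA] := sys_four sy (erefl _).
have rs : #|Z| = s := sys_rest sy.
by rewrite -rs; apply: (four_strict e_sym deg6 (core_four (sys_core sy)) nbA cA); rewrite rs.
Qed.

End Systems.

(** * Four accessible classes *)

Definition closed_nb (V : finType) (e : rel V) x := x |: nb e x.

Lemma in_closed_nb (V : finType) (e : rel V) x y : (y \in closed_nb e x) = (y == x) || e x y.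
Proof. by rewrite !inE. Qed.

Lemma card_closed_nb (V : finType) (e : rel V) x : irreflexive e ->
  #|closed_nb e x| = #|nb e x|.+1.
Proof. by move=> e_irr; rewrite cardsU1 inE e_irr. Qed.

(** Disjoint copies of [K_7] and isolated vertices: a copy is encoded as the closed neighbourhood
    common to its seven vertices, and [m] counts the copies. *)
Definition septuples (V : finType) (e : rel V) m := exists D : {set V},
  [/\ forall x, x \in D -> #|closed_nb e x| = 7,
      forall x y, x \in D -> y \in closed_nb e x -> y \in D /\ closed_nb e y = closed_nb e x,
      forall x, x \notin D -> nb e x = set0 & #|closed_nb e @: D| = m].

Lemma card_fibers (T T' : finType) (h : T -> T') (A : {set T}) k :
  (forall x, x \in A -> #|[set y in A | h y == h x]| = k) -> #|A| = k * #|h @: A|.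
Proof.
move=> H; rewrite -sum1_card (partition_big_imset h) /= mulnC -sum_nat_const.
apply: eq_bigr => b /imsetP[x xA ->]; rewrite sum1dep_card.
by rewrite -(H x xA); apply: eq_card => y; rewrite !inE.
Qed.

Section Extremal.
Variables (V : finType) (e : rel V) (p s : nat).
Hypotheses (e_sym : symmetric e) (e_irr : irreflexive e) (p_gt0 : 0 < p).
Hypotheses (deg6 : forall x, #|nb e x| <= 6) (s_lt : s < 3 * p).
Hypotheses (cardV : #|V| = 4 * p - 1 + s) (bad : ~~ good e p 4 (setT :\: set0)).
Hypothesis (few : ends e <= 14 * s).
Implicit Types (A B U W X Z R : {set V}) (L M : seq {set V}) (x y z w : V).

Local Notation "'N' x" := (nb e x) (at level 10, x at level 8).
Local Notation longest4 := (longest e p setT 4 set0).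

Lemma card_rest L : longest4 L -> #|setT :\: cov L| = (4 - size L) * p + s.
Proof.
case=> [[ch sL sc _] _]; have := chain_cov_card p_gt0 ch.
have L0 : 0 < size L by case: (L) ch.
rewrite cards0 addn0 cardsD setTI cardsT cardV => E.
by move: sc E p_gt0 L0; rewrite mulnBl; clear; nia.
Qed.

Lemma longest4_core L : longest4 L -> core e p L (setT :\: cov L) (4 - size L).
Proof.
move=> lo; rewrite -[X in core _ _ X](cats0 L).
exact: (core_extend e_sym e_irr p_gt0 (core_nil e p setT 4) (or_introl (erefl _)) bad lo).
Qed.

(** Fewer than four classes would start the nested construction, and [sys_strict] would contradict
    [few]. *)
Lemma longest4_size L : optimal e p setT 4 set0 L -> size L = 4.
Proof.
move=> op; have [lo _] := op; have [ch sL sc gZ] := lo.1; have co := longest4_core lo.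
apply/eqP; rewrite eqn_leq sc leqNgt; apply/negP => lt.
suff sy : sys e p s L (setT :\: cov L) (4 - size L).
  by have := sys_strict e_sym e_irr p_gt0 deg6 s_lt sy; rewrite ltnNge few.
have L0 : L != [::] by case: (L) ch.
split=> //; last 1 first.
- by move=> E; rewrite E in lt.
- by rewrite subnKC.
- by apply/setP => u; rewrite !inE; case: (_ \in _).
- by move=> W WL; have := chain_mem_card ch WL; rewrite setD0.
- exact: card_rest.
- move=> W L2 z w LE zZ gz so; rewrite LE in op co zZ gz *.
  have := level_deg e_sym e_irr p_gt0 (core_nil e p setT 4) _ bad op zZ gz so.
  by rewrite !cats0; apply.
- move=> A B C LE; rewrite LE in lo gZ *.
  have [/exists_inP[y yC fy]|no] := boolP [exists y in C, free e y A]; last first.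
    by left => y yC; apply: contra no => fy; apply/exists_inP; exists y.
  (* Some vertex of [C] can move straight to the root, so [B] and [C] may change places. With [B]
     latest, an exchange in [B] has no later class to respect. *)
  right; have lo' : longest4 [:: B; C; A].
    have cE : cov [:: B; C; A] = cov [:: C; B; A] by rewrite /= setUCA.
    have [[chL _ _ _] mx] := lo; split; last by move=> M /mx.
    split; rewrite ?cE //.
    case/chain_consP: chL => // iC cC dC _ /chain_consP[]// iB cB dB [X [x [XA xB fx]]] chA.
    rewrite /= setU0 in dB dC; move: dC; rewrite disjoint_sym disjUl => /andP[dBC dAC].
    apply/chain_consP => //; split=> //.
    + by rewrite /= setU0 disjoint_sym disjUl [[disjoint C & B]]disjoint_sym dBC disjoint_sym.
    + by exists X, x; rewrite inE XA orbT.
    apply/chain_consP => //; split=> //; first by rewrite /= setU0 disjoint_sym.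
    by exists A, y; rewrite mem_head setD0.
  have cE : setT :\: cov [:: B; C; A] = setT :\: cov [:: C; B; A] by rewrite /= setUCA.
  move=> z z' w zZ z'Z zz' gz so so'; rewrite -cE in zZ z'Z gz.
  exact: (@longest_swap_clique _ _ _ e_sym e_irr p_gt0 setT 4 set0 bad [::] B [:: C; A] z z' w lo' zZ gz so).
Qed.

(** The sets left over by four accessible classes. The structure of the graph is read off from their
    stability under exchanges. *)
Definition state R := exists L, [/\ longest4 L, size L = 4 & R = setT :\: cov L].

Lemma state_exists W : indep e W -> #|W| = p.-1 -> good e p 3 (setT :\: W) -> exists R, state R.
Proof.
move=> iW cW gW; have lv0 : lv e p setT 4 set0 [:: W].
  by split; rewrite ?subsetT //= ?sub0set ?iW ?setD0 ?cW ?eqxx ?setU0.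
have [L op] := optimal_exists lv0.
by exists (setT :\: cov L), L; split; rewrite ?longest4_size //; case: op.
Qed.

Lemma state_card R : state R -> #|R| = s.
Proof. by case=> [L [lo sL ->]]; rewrite card_rest // sL. Qed.

(** If every vertex of the latest class [D] sees the root [A], [four_strict] gives too many edges.
    Otherwise [D] can pass a vertex directly to [A], so the order [A], [D], [B], [C] is a chain too,
    and the exceptions that [four_tight] leaves for the two orders are incompatible. *)
Lemma state_two R z : state R -> z \in R -> #|N z :&: R| = 2.
Proof.
move=> st; have cR := state_card st.
move=> zR; case: st => [[|D [|C [|B [|A [|X L]]]]] [lo sL RE]] //.
have four := core_four (longest4_core lo); rewrite -RE in four.
have [[ch _ _ gZ] mx] := lo.
case/chain_consP: (ch) => // iD cD dD _ /chain_consP[]// iC cC dC [XC [xC [XCA xCC fxC]]].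
case/chain_consP => // iB cB dB [XB [xB [XBA xBB fxB]]] chA.
rewrite /= ?setU0 in dB dC dD.
have [/exists_inP[y yD fy]|no] := boolP [exists y in D, free e y A]; last first.
  have H y : y \in D -> ~~ free e y A.
    by move=> yD; apply: contra no => fy; apply/exists_inP; exists y.
  have lt : #|R| < 3 * p by rewrite cR.
  by have := four_strict e_sym deg6 four H cD lt; rewrite cR ltnNge few.
have cE : cov [:: C; B; D; A] = cov [:: D; C; B; A].
  by apply/setP => u; rewrite /= !inE; bsolve.
have lo' : longest4 [:: C; B; D; A].
  split; last by move=> M /mx.
  split; rewrite ?cE //.
  move: dD; rewrite disjoint_sym !disjUl => /and3P[dCD dBD dAD].
  move: dC; rewrite disjoint_sym disjUl => /andP[dBC dAC].
  have sy (X Y : {set V}) : [disjoint X & Y] -> [disjoint Y & X] by rewrite disjoint_sym.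
  apply/chain_consP => //; split=> //.
  - by rewrite /= setU0 disjoint_sym !disjUl dBC dAC sy.
  - by exists XC, xC; split=> //; move: XCA; rewrite !inE => /orP[] ->; rewrite ?orbT.
  apply/chain_consP => //; split=> //.
  - by rewrite /= setU0 disjoint_sym !disjUl (sy _ _ dBD) (sy _ _ dB).
  - by exists XB, xB; split=> //; move: XBA; rewrite !inE => ->; rewrite ?orbT.
  apply/chain_consP => //; split=> //; first by rewrite /= setU0 sy.
  by exists A, y; rewrite mem_head setD0.
have four' := core_four (longest4_core lo'); rewrite cE -RE in four'.
have few' : ends e <= 14 * #|R| by rewrite cR.
have [d1 d2 d3 d4 d5] := four_deg deg6 four zR.
have := four_tight e_sym deg6 four few' zR; have := four_tight e_sym deg6 four' few' zR.
by move: d1 d2 d3 d4 d5; clear; lia.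
Qed.

Lemma cov_mem L x : x \in cov L -> exists2 W, W \in L & x \in W.
Proof.
elim: L => [|W L IH] /=; first by rewrite inE.
rewrite inE => /orP[xW|/IH[X XL xX]]; first by exists W; rewrite ?mem_head.
by exists X; rewrite // inE XL orbT.
Qed.

Lemma state_sole L z : longest4 L -> size L = 4 -> z \in setT :\: cov L ->
  forall W, W \in L -> #|N z :&: W| = 1.
Proof.
move=> lo sL zR W WL; have st : state (setT :\: cov L) by exists L.
have := state_two st zR; case: L lo sL zR WL {st} => [|D [|C [|B [|A [|X L]]]]] lo sL zR WL //.
have [d1 d2 d3 d4 d5] := four_deg deg6 (core_four (longest4_core lo)) zR.
by move: WL; rewrite !inE => /or4P[] /eqP-> {W}; move: d1 d2 d3 d4 d5; clear; lia.
Qed.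

Lemma state_deg R z : state R -> z \in R -> #|N z| = 6.
Proof.
move=> st zR; have two := state_two st zR; apply/eqP; rewrite eqn_leq deg6 /=.
case: st => [[|D [|C [|B [|A [|X L]]]]] [lo sL RE]] //; rewrite RE in zR two.
have four := core_four (longest4_core lo).
have [d1 d2 d3 d4 _] := four_deg deg6 four zR; case: four => /and4P[h0 h1 h2 h3] _ _ _ _ _.
have := subset_leq_card (subsetIl (N z) ((((setT :\: cov [:: D; C; B; A]) :|: A) :|: B) :|: C :|: D)).
by rewrite !card_split // two; move: d1 d2 d3 d4; clear; lia.
Qed.

Lemma state_clique R z z' w : state R -> z \in R -> z' \in R -> z != z' -> w \notin R ->
  e z w -> e z' w -> e z z'.
Proof.
case=> L [lo sL RE] zR z'R zz' wR ezw ez'w; rewrite RE in zR z'R wR.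
have [W WL wW] : exists2 W, W \in L & w \in W.
  by apply: cov_mem; move: wR; rewrite in_setD in_setT andbT negbK.
have so u : u \in setT :\: cov L -> e u w -> sole e u W w.
  by move=> uR euw; apply: sole1 => //; apply: (state_sole lo sL uR WL).
apply: (core_clique (longest4_core lo) WL zR z'R zz' _ (so _ zR ezw) (so _ z'R ez'w)).
by rewrite sL.
Qed.

(** As [z] has a single neighbour in every class, [sole_later] permits the exchange in any class,
    not only in the latest. *)
Lemma state_swap R z w : state R -> z \in R -> w \notin R -> e z w -> state (w |: R :\ z).
Proof.
case=> L [lo sL RE] zR wR ezw; rewrite RE in zR wR.
have [W WL wW] : exists2 W, W \in L & w \in W.
  by apply: cov_mem; move: wR; rewrite in_setD in_setT andbT negbK.
have al X : X \in L -> exists y, sole e z X y.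
  move=> XL; have /eqP/cards1P[y yE] := state_sole lo sL zR XL; by exists y; apply/eqP.
have so : sole e z W w by apply: sole1 => //; apply: (state_sole lo sL zR WL).
have gz : good e p (4 - size L) ((setT :\: cov L) :\ z) by rewrite sL.
case/path.splitPr: WL lo sL zR gz al RE => L1 L2 lo sL zR gz al RE.
have al1 X : X \in L1 -> exists y, sole e z X y by move=> XL; apply: al; rewrite mem_cat XL.
have fwd := sole_later e_sym e_irr p_gt0 bad lo zR gz al1.
have [lo' cE] := longest_swap e_sym e_irr p_gt0 bad lo zR gz so fwd.
exists (L1 ++ (z |: W :\ w) :: L2); split=> //.
  by move: sL; rewrite !size_cat.
rewrite cE RE; apply/setP => u; move: (wR); rewrite !inE.
case: (eqVneq u w) => [->|_] //=; first by case: eqP => // wz; move: ezw; rewrite wz e_irr.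
by case: (u == z).
Qed.

(** By [state_two], [x] has two neighbours in the rest before and after the exchange; having lost
    [z], it must have gained [w]. *)
Lemma state_swap_adj R z w x : state R -> z \in R -> w \notin R -> e z w -> x \in R -> e x z ->
  e x w.
Proof.
move=> st zR wR ezw xR exz; have st' := state_swap st zR wR ezw.
have xz : x != z by apply/negP => /eqP E; rewrite E e_irr in exz.
have xR' : x \in w |: R :\ z by rewrite !inE xz xR orbT.
have two := state_two st xR; have := state_two st' xR'; apply: contra_eqT => nxw.
have -> : N x :&: (w |: R :\ z) = (N x :&: R) :\ z.
  by apply/setP => u; rewrite !inE; case: (eqVneq u w) => [->|_]; rewrite ?(negPf nxw) ?(negPf wR) ?andbF //= andbCA.
by have := cardsD1 z (N x :&: R); rewrite two !inE exz zR; clear; lia.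
Qed.

Local Notation cnb := (closed_nb e).

Lemma state_block R z : state R -> z \in R -> {in cnb z &, forall x y, x != y -> e x y}.
Proof.
move=> st zR.
have inin x y : x \in N z -> y \in N z -> x \in R -> y \notin R -> e x y.
  rewrite !inE => ezx ezy xR yR; apply: (state_swap_adj st zR yR ezy xR).
  by rewrite e_sym.
have nn x y : x \in N z -> y \in N z -> x != y -> e x y.
  move=> xN yN xy; have [xR|xR] := boolP (x \in R); have [yR|yR] := boolP (y \in R).
  (* Four of the six neighbours of [z] lie outside [R]; any of them is adjacent to both [x] and [y],
     and [state_clique] applies. *)
  - have [w wN wR] : exists2 w, w \in N z & w \notin R.
      have : 0 < #|N z :\: R|.
        by have := cardsID R (N z); rewrite (state_two st zR) (state_deg st zR); clear; lia.
      by case/card_gt0P => w; rewrite inE => /andP[wR wN]; exists w.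
    exact: (state_clique st xR yR xy wR (inin _ _ xN wN xR wR) (inin _ _ yN wN yR wR)).
  - exact: inin.
  - by rewrite e_sym; apply: inin.
  (* After exchanging [z] with [x], the vertex [x] belongs to the rest and is adjacent to [u];
     exchanging [u] with [y] then makes [x] adjacent to [y]. *)
  - have [u uN] : exists u, u \in N z :&: R by apply/card_gt0P; rewrite (state_two st zR).
    move: uN; rewrite inE => /andP[uN uR].
    have ezx : e z x by move: xN; rewrite inE.
    have uz : u != z by apply/negP => /eqP E; move: uN; rewrite E inE e_irr.
    have ux := inin _ _ uN xN uR xR; have uy := inin _ _ uN yN uR yR.
    have st' := state_swap st zR xR ezx.
    apply: (state_swap_adj st' (z := u)) => //.
    + by rewrite !inE uz uR orbT.
    + by rewrite !inE eq_sym (negPf xy) (negPf yR) andbF.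
    + by rewrite !inE eqxx.
    + by rewrite e_sym.
move=> x y /setU1P[->|xN] /setU1P[->|yN]; first by rewrite eqxx.
- by move: yN; rewrite inE.
- by move: xN; rewrite inE e_sym.
- exact: nn.
Qed.

(** Each block meets [R] in a vertex and its two neighbours there, whence [s = 3 * m]. The blocks
    already use [6 * 7 * m = 14 * s] ends, so all other vertices are isolated. *)
Lemma state_septuples R : state R -> exists m, s = 3 * m /\ septuples e m.
Proof.
move=> st; have blk := state_block st; pose D := \bigcup_(z in R) cnb z.
have c7 z : z \in R -> #|cnb z| = 7.
  by move=> zR; rewrite card_closed_nb ?(state_deg st zR).
have cE z x : z \in R -> x \in cnb z -> cnb x = cnb z.
  move=> zR xz; apply/esym/eqP; rewrite eqEcard (c7 z zR) card_closed_nb // ltnS deg6 andbT.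
  apply/subsetP => y yz; rewrite in_closed_nb; case: (eqVneq y x) => //= yx.
  by apply: (blk z zR) => //; rewrite eq_sym.
have cxx x : x \in cnb x by rewrite in_closed_nb eqxx.
have inD x : x \in D -> exists2 z, z \in R & x \in cnb z by case/bigcupP => z; exists z.
have D2 x y : x \in D -> y \in cnb x -> y \in D /\ cnb y = cnb x.
  case/inD => z zR xz; rewrite (cE z x) // => yz; rewrite (cE z y) //; split=> //.
  by apply/bigcupP; exists z.
have D7 x : x \in D -> #|cnb x| = 7 by case/inD => z zR /(cE z x zR) ->; apply: c7.
have RD : cnb @: R = cnb @: D.
  apply/setP => b; apply/imsetP/imsetP => [[z zR ->]|[x /inD[z zR xz] ->]].
    by exists z => //; apply/bigcupP; exists z.
  by exists z => //; apply: cE.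
have cR : #|R| = 3 * #|cnb @: R|.
  apply: card_fibers => z zR; have -> : [set y in R | cnb y == cnb z] = z |: (N z :&: R).
    apply/setP => y; rewrite !inE; apply/andP/orP => [[yR /eqP yz]|[/eqP->//|/andP[ezy yR]]].
      by have := cxx y; rewrite yz in_closed_nb yR andbT => /orP.
    by split=> //; rewrite (cE z y) // in_closed_nb ezy orbT.
  by rewrite cardsU1 (state_two st zR) !inE e_irr.
have cD : #|D| = 7 * #|cnb @: D|.
  apply: card_fibers => x xD; rewrite -(D7 x xD); apply: eq_card => y; rewrite inE.
  apply/andP/idP => [[_ /eqP<-]//|yx]; have [yD ->] := D2 x y xD yx; by rewrite yD.
have sE : s = 3 * #|cnb @: D| by rewrite -(state_card st) cR RD.
exists #|cnb @: D|; split=> //; exists D; split=> // x xD.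
have : \sum_(y in ~: D) #|N y| = 0.
  have eD : \sum_(y in D) #|N y| = 6 * #|D|.
    rewrite mulnC -sum_nat_const; apply: eq_bigr => y yD; have := D7 y yD.
    by rewrite card_closed_nb // => -[->].
  have : ends e = \sum_(y in D) #|N y| + \sum_(y in ~: D) #|N y|.
    by rewrite /ends (bigID (mem D)) /=; congr (_ + _); apply: eq_bigl => y; rewrite inE.
  by rewrite eD cD; move: few sE; clear; lia.
move=> /eqP; rewrite sum_nat_eq0 => /forall_inP /(_ x); rewrite inE xD => /(_ isT) H.
by apply/eqP; rewrite -cards_eq0.
Qed.

End Extremal.

(** * Induction by removing one edge *)

Section EdgeRemoval.
Variables (V : finType) (p s : nat).
Hypotheses (p_gt0 : 0 < p) (s_gt0 : 0 < s) (s_lt : s < 3 * p) (cardV : #|V| = 4 * p - 1 + s).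
Implicit Types (U W A B : {set V}) (e : rel V).

Definition remove_edge e u v : rel V :=
  fun x y => e x y && ~~ (((x == u) && (y == v)) || ((x == v) && (y == u))).

Lemma good_empty e k U : (forall x y, ~~ e x y) -> k * p <= #|U| -> good e p k U.
Proof.
move=> e0; elim: k U => //= k IH U le.
have [B [sB cB]] : exists B : {set V}, B \subset U /\ #|B| = p.
  have [B /andP[sB /eqP cB]] : exists B : {set V}, (B \subset U) && (#|B| == p).
    have : p <= #|U| by move: le; clear; lia.
    rewrite -bin_gt0 -(cards_draws U p) => /card_gt0P[B]; rewrite inE => H; by exists B.
  by exists B.
apply/existsP; exists B; rewrite sB cB eqxx /=; apply/andP; split.
  by apply/indepP => x y _ _.
apply: IH; rewrite cardsD (setIidPr sB) cB; by move: le; clear; lia.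
Qed.

Lemma good_restore e u v k U : u \notin U -> good (remove_edge e u v) p k U -> good e p k U.
Proof.
elim: k U => //= k IH U uU /existsP[B /and4P[sB /indepP iB cB gB]]; apply/existsP; exists B.
rewrite sB cB IH ?gB //= ?andbT; last by rewrite inE negb_and uU orbT.
have uB : u \notin B by apply: contra uU; apply: (subsetP sB).
apply/indepP => x y xB yB; have := iB x y xB yB; rewrite /remove_edge.
have /negPf-> : x != u by apply: contra uB => /eqP<-.
have /negPf-> : y != u by apply: contra uB => /eqP<-.
by rewrite andbF andbT.
Qed.

(** Only a class containing both [u] and [v] can fail when the edge returns. Without [u] it is a
    root of [p - 1] vertices, and the other classes avoid [u], hence remain independent. *)
Lemma good_near e u v k U : irreflexive e -> good (remove_edge e u v) p k U -> good e p k U \/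
  exists k', k = k'.+1 /\
    exists W, [/\ W \subset U, indep e W, #|W| = p.-1 & good e p k' (U :\: W)].
Proof.
move=> e_irr; elim: k U => [|k IH] U; first by left.
move=> /= /existsP[B /and4P[sB iB /eqP cB gB]].
have [iB'|niB] := boolP (indep e B).
  case: (IH _ gB) => [g|[k' [-> [W [sW iW cW gW]]]]].
    by left; apply/existsP; exists B; rewrite sB iB' cB eqxx.
  right; exists k'.+1; split=> //; exists W; split=> //; first exact: subset_trans sW (subsetDl _ _).
  move: sW; rewrite subsetD => /andP[sW dW].
  apply/existsP; exists B; rewrite subsetD sB iB' cB eqxx disjoint_sym dW /=.
  by move: gW; rewrite !setDDl setUC.
right; exists k; split=> //; exists (B :\ u).
have uvB x y : x \in B -> y \in B -> e x y -> (x == u) && (y == v) || (x == v) && (y == u).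
  by move=> xB yB exy; have := indepP _ _ iB x y xB yB; rewrite /remove_edge exy negbK.
have uB : u \in B.
  apply: contraR niB => uB; apply/indepP => x y xB yB; apply/negP => exy.
  by case/orP: (uvB x y xB yB exy) => /andP[/eqP E1 /eqP E2]; move: uB; rewrite -?E1 -?E2 ?xB ?yB.
split.
- exact: subset_trans (subD1set _ _) sB.
- apply/indepP => x y; rewrite !inE => /andP[xu xB] /andP[yu yB]; apply/negP => exy.
  by case/orP: (uvB x y xB yB exy); rewrite ?(negPf xu) ?(negPf yu) ?andbF.
- by have := cardsD1 u B; rewrite uB cB => ->.
- apply: (@goodS _ e p k (U :\: B)); first by apply: setDS; apply: subD1set.
  by apply: good_restore gB; rewrite inE uB.
Qed.

Lemma good_or_septuples e : symmetric e -> irreflexive e -> (forall x, #|nb e x| <= 6) ->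
  ends e <= 14 * s -> good e p 4 setT \/ exists m, s = 3 * m /\ septuples e m.
Proof.
have [n le] := ubnP (ends e); elim: n e le => // n IH e; rewrite ltnS => le e_sym e_irr deg6 few.
have [g|bad] := boolP (good e p 4 setT); first by left.
right; case: (boolP [exists u, exists v, e u v]) => [/existsP[u /existsP[v euv]]|no]; last first.
  case/negP: bad; apply: good_empty => [x y|].
    by apply: contra no => exy; apply/existsP; exists x; apply/existsP; exists y.
  by rewrite cardsT cardV; move: s_gt0 p_gt0; clear; lia.
pose e' := remove_edge e u v.
have sub x : nb e' x \subset nb e x by apply/subsetP => y; rewrite !inE => /andP[].
have lt : ends e' < ends e.
  rewrite /ends (bigD1 u) //= [X in _ < X](bigD1 u) //= -addSn; apply: leq_add.
    apply: proper_card; apply/properP; split=> //; exists v; first by rewrite inE.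
    by rewrite !inE /e' /remove_edge euv !eqxx.
  by apply: leq_sum => x _; apply: subset_leq_card.
have e'_sym : symmetric e'.
  by move=> x y; rewrite /e' /remove_edge e_sym orbC [(x == v) && _]andbC [(x == u) && _]andbC.
have e'_irr : irreflexive e' by move=> x; rewrite /e' /remove_edge e_irr.
have deg6' x : #|nb e' x| <= 6 by apply: leq_trans (subset_leq_card (sub x)) (deg6 x).
have few' : ends e' <= 14 * s by apply: leq_trans (ltnW lt) few.
have bad0 : ~~ good e p 4 (setT :\: set0) by rewrite setD0.
case: (IH e' (leq_trans lt le) e'_sym e'_irr deg6' few') => [g'|[m [sE [D [D7 D2 D0 cD]]]]].
  case: (good_near e_irr g') => [g|[_ [[<-] [W [_ iW cW gW]]]]]; first by rewrite g in bad.
  have [R st] := state_exists e_sym e_irr p_gt0 deg6 s_lt cardV bad0 few iW cW gW.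
  exact: state_septuples st.
(* If the smaller graph is extremal, it already has [14 * s] ends, and the removed edge exceeds the
   bound. *)
have : #|D| = 7 * m.
  rewrite -cD; apply: card_fibers => x xD; rewrite -(D7 x xD); apply: eq_card => y; rewrite inE.
  apply/andP/idP => [[_ /eqP<-]|yx]; first by rewrite in_closed_nb eqxx.
  by have [yD ->] := D2 x y xD yx; rewrite yD.
have : 6 * #|D| <= ends e'.
  rewrite /ends (bigID (mem D)) /= mulnC -sum_nat_const; apply: leq_trans (leq_addr _ _).
  by apply: leq_sum => x xD; have := D7 x xD; rewrite card_closed_nb // => -[->].
by move: lt few sE; clear; lia.
Qed.

End EdgeRemoval.

(** * Simple graphs *)

Section SimpleGraphs.
Variable G : sgraph.

Lemma ends_edges : ends (@adj G) <= 2 * #|edges G|.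
Proof.
have -> : ends (@adj G) = #|[set xy : G * G | adj xy.1 xy.2]|.
  rewrite /ends -sum1dep_card -(pair_big_dep xpredT (fun x y => adj x y) (fun _ _ => 1)) /=.
  by apply: eq_bigr => x _; rewrite sum1_card; apply: eq_card => y; rewrite !inE.
set P := [set _ | _].
have -> : edges G = (fun xy : G * G => [set xy.1; xy.2]) @: P.
  by apply/setP => E; apply/imsetP/imsetP => -[xy xyP ->]; exists xy => //; move: xyP; rewrite !inE.
rewrite -sum1_card (partition_big_imset (fun xy : G * G => [set xy.1; xy.2])) /= mulnC -sum_nat_const.
apply: leq_sum => E /imsetP[[x y] _ ->] /=; rewrite sum1dep_card.
apply: (@leq_trans #|[set (x, y); (y, x)]|); last by rewrite cards2; case: (_ != _).
apply: subset_leq_card; apply/subsetP => -[a b]; rewrite inE /= => /andP[].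
rewrite inE /= => ab /eqP Eab; have anb : a != b by apply/negP => /eqP E'; rewrite E' adj_irrefl in ab.
have : a \in [set x; y] by rewrite -Eab !inE eqxx.
have : b \in [set x; y] by rewrite -Eab !inE eqxx orbT.
rewrite !inE !xpair_eqE => /orP[] /eqP Eb /orP[] /eqP Ea; move: anb;
  by rewrite Ea Eb ?eqxx ?orbT.
Qed.

Lemma good_family p k (U : {set G}) : good (@adj G) p k U -> exists B : nat -> {set G},
  (forall i, i < k -> [/\ B i \subset U, indep (@adj G) (B i) & #|B i| = p]) /\
  (forall i j, i < j < k -> [disjoint B i & B j]).
Proof.
elim: k U => [|k IH] U; first by move=> _; exists (fun=> set0); split=> // i j; rewrite ltn0 andbF.
move=> /= /existsP[B0 /and4P[sB iB /eqP cB /IH[B [H1 H2]]]].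
exists (fun i => if i is i'.+1 then B i' else B0); split.
  case=> [|i] // /H1[s i' c]; split=> //; exact: subset_trans s (subsetDl _ _).
case=> [|i] [|j] //=; last exact: H2.
by move=> /H1[s _ _]; move: s; rewrite subsetD disjoint_sym => /andP[].
Qed.

Lemma good_copies p k : good (@adj G) p k setT ->
  contains_copy (complement G) (copies k (complete p)).
Proof.
case/good_family => B [H1 H2].
have cB (i : 'I_k) : #|B i| = p by case: (H1 i (ltn_ord i)).
have dB (i j : 'I_k) x : x \in B i -> x \in B j -> i = j.
  move=> xi xj; apply: val_inj; case: (ltngtP i j) => // lt.
    by have := H2 i j; rewrite lt ltn_ord => /(_ isT)/disjointFr/(_ xi); rewrite xj.
  by have := H2 j i; rewrite lt ltn_ord => /(_ isT)/disjointFr/(_ xj); rewrite xi.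
pose f (u : copies k (complete p)) : complement G := enum_val (cast_ord (esym (cB u.1)) u.2).
have fB u : f u \in B u.1 by apply: enum_valP.
have f_inj : injective f.
  move=> [i a] [j b] E; have ij : i = j.
    by apply: (dB i j (f (i, a))); [apply: fB | rewrite E; apply: fB].
  by subst j; move/enum_val_inj/cast_ord_inj: E => /= ->.
exists f; split=> // u v /andP[/eqP E12 ne]; apply/andP; split.
  by apply: contra ne => /eqP/f_inj->.
have [_ /indepP iB _] := H1 u.1 (ltn_ord _).
by apply: iB; rewrite ?fB // E12.
Qed.

Lemma septuples_iso m : septuples (@adj G) m ->
  isomorphic G (dunion (copies m (complete 7)) (edgeless (#|G| - 7 * m))).
Proof.
case=> D [D7 D2 D0 cm]; pose c := closed_nb (@adj G).
have cxx x : x \in c x by rewrite in_closed_nb eqxx.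
have cD : #|D| = 7 * m.
  rewrite -cm; apply: card_fibers => x xD; rewrite -(D7 x xD); apply: eq_card => y; rewrite inE.
  apply/andP/idP => [[_ /eqP<-]|yx]; first exact: cxx.
  by have [yD ->] := D2 x y xD yx; rewrite yD.
set T := dunion _ _.
(* The isomorphism is prescribed by coordinates: the position of the block in an enumeration of the
   blocks and of [x] in its block, or the position of [x] among the isolated vertices. *)
pose Q (x : G) (t : T) := match t with
  | inl (i, j) => [/\ x \in D, i = index (c x) (enum (c @: D)) :> nat & j = index x (enum (c x)) :> nat]
  | inr j => x \notin D /\ j = index x (enum (~: D)) :> nat end.
have /fin_all_exists[f fQ] : forall x, exists t, Q x t.
  move=> x; have [xD|xD] := boolP (x \in D).
    have h1 : index (c x) (enum (c @: D)) < m.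
      by rewrite -cm cardE index_mem mem_enum imset_f.
    have h2 : index x (enum (c x)) < 7.
      by rewrite -(D7 x xD) cardE index_mem mem_enum cxx.
    by exists (inl (Ordinal h1, Ordinal h2)).
  have h : index x (enum (~: D)) < #|G| - 7 * m.
    have -> : #|G| - 7 * m = #|~: D| by rewrite cardsCs setCK cD.
    by rewrite cardE index_mem mem_enum inE.
  by exists (inr (Ordinal h)).
have idx (S : finType) (A : {set S}) (a b : S) : a \in A -> b \in A ->
    index a (enum A) = index b (enum A) -> a = b.
  by move=> aA bA E; rewrite -[a](nth_index a (s := enum A)) ?mem_enum // E nth_index ?mem_enum.
have f_inj : injective f.
  move=> x y E; have := fQ x; have := fQ y; rewrite E; case: (f y) => [[i j]|j] /=.
    case=> yD -> -> [xD E1 E2]; have cE : c y = c x by apply: idx E1; apply: imset_f.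
    by rewrite cE in E2; apply/esym/(idx _ _ _ _ _ _ E2); rewrite // -cE.
  by case=> yD -> [xD E1]; apply/esym/(idx _ _ _ _ _ _ E1); rewrite inE.
have adjD x y : x \in D -> adj x y -> y \in D /\ c y = c x.
  by move=> xD xy; apply: D2 => //; rewrite in_closed_nb xy orbT.
have adj0 x y : x \notin D -> adj x y = false.
  by move=> /D0 E; apply/negP => xy; have : y \in nb (@adj G) x by [rewrite inE]; rewrite E inE.
exists f; split.
  apply: inj_card_bij => //; rewrite card_sum card_prod !card_ord.
  by rewrite mulnC -cD subnKC // max_card.
move=> x y; have := fQ x; have := fQ y.
case: (f x) => [[i j]|j]; case: (f y) => [[i' j']|j'] /=.
- case=> yD Ei' Ej' [xD Ei Ej]; rewrite -[LHS]/((i == i') && (j != j')).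
  apply/andP/idP => [[/eqP ii jj]|xy].
    have cE : c x = c y by apply: (idx _ (c @: D)); rewrite ?imset_f // -Ei -Ei' ii.
    have : y \in c x by rewrite cE.
    rewrite in_closed_nb => /orP[/eqP yx|//]; case/negP: jj; apply/eqP/val_inj.
    by rewrite /= Ej Ej' yx.
  have [_ cE] := adjD x y xD xy; split; first by apply/eqP/val_inj; rewrite /= Ei Ei' cE.
  apply/negP => /eqP jj; have : x = y.
    by apply: (idx _ (c x) x y (cxx x)); [rewrite -cE | rewrite -Ej jj Ej' cE].
  by move=> E; rewrite E adj_irrefl in xy.
- case=> yD _ [xD _ _]; rewrite -[LHS]/false; apply/esym/negP => xy.
  by have [] := adjD x y xD xy; rewrite (negPf yD).
- case=> yD _ _ [xD _]; by rewrite -[LHS]/false adj0.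
- by case=> yD _ [xD _]; rewrite -[LHS]/false adj0.
Qed.

End SimpleGraphs.

Theorem theorem2p7 (p s : nat) (hp : 3 <= p) (hs : 1 <= s <= 3 * p - 1)
  (G : sgraph) (hn : #|G| = 4 * p - 1 + s)
  (hE : #|edges G| <= 7 * s) (hD : max_degree G <= 6) :
  contains_copy (complement G) (copies 4 (complete p)) \/
  (3 %| s /\
   isomorphic G
     (dunion (copies (s %/ 3) (complete 7))
             (edgeless (#|G| - (7 * s) %/ 3)))).
Proof.
have p_gt0 : 0 < p by apply: leq_trans hp.
case/andP: hs => s_gt0 hs.
have s_lt : s < 3 * p by move: hs hp; clear; lia.
have deg6 (x : G) : #|nb (@adj G) x| <= 6.
  by apply: leq_trans hD; apply: (leq_bigmax x).
have few : ends (@adj G) <= 14 * s.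
  by apply: leq_trans (ends_edges G) _; move: hE; clear; lia.
case: (good_or_septuples p_gt0 s_gt0 s_lt hn (@adj_sym G) (@adj_irrefl G) deg6 few).
  by move=> g; left; apply: good_copies.
case=> m [-> sep]; right; split; first exact: dvdn_mulr.
by rewrite mulnCA !mulKn //; apply: septuples_iso.
Qed.
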